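(* Let $\mathcal{G}$ be an ideal of graphs and let $\mathcal{A}$ be the class of all forests. Then $\kappa_{\mathcal{A}}$ is bounded on $\mathcal{G}$ if and only if $\operatorname{FAN}(K_3,S) \not\subseteq \mathcal{G}$ for every $S \subseteq V(K_3)$ with $|S| \leq 1$.
   Context: All graphs are finite and simple. $H$ is a topological minor of $G$ if $G$ has a subgraph isomorphic to a subdivision of $H$ (edges replaced by internally disjoint paths of length at least $1$). An ideal is a class of graphs closed under isomorphisms and taking topological minors. For a class $\mathcal{C}$ of graphs and a graph $G$, $\kappa_{\mathcal{C}}(G)$ ($\mathcal{C}$-vertex-brittleness) is the minimum $\ell$ such that there is a partition $(E_1,\dots,E_n)$ of $E(G)$ for which the subgraph of $G$ induced by the edges in $E_i$ (consisting of those edges and their ends) belongs to $\mathcal{C}$ for each $i$, and the number of vertices incident with edges in distinct $E_i$'s is $\ell$. A graph parameter $f$ is bounded on a class $\mathcal{G}$ if there is a constant $M$ with $|f(G)|\le M$ for all $G\in\mathcal{G}$. For a graph $G$, $S\subsetneq V(G)$ and a positive integer $k$, $\operatorname{Fan}(G,S,k)$ is the graph obtained from $k$ vertex-disjoint copies of $G$ by identifying all the copies of $v$ for each $v\in S$ and identifying all the copies of $e$ for each $e\in E(G[S])$. $\operatorname{FAN}(G,S)$ is the ideal of all graphs isomorphic to a topological minor of $\operatorname{Fan}(G,S,k)$ for some positive integer $k$. *)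

(* Defs.v *)
From mathcomp Require Import all_boot.
From mathcomp Require Import boolp.

Set Implicit Arguments.
Unset Strict Implicit.
Unset Printing Implicit Defensive.

Record sgraph := SGraph {
  vertex :> finType;
  adj : rel vertex;
  adj_sym : symmetric adj;
  adj_irrefl : irreflexive adj }.

Definition graph_class := sgraph -> Prop.

Definition subclass (A B : graph_class) : Prop := forall G, A G -> B G.

Definition isomorphic (G H : sgraph) : Prop :=
  exists2 f : G -> H, bijective f & {mono f : x y / adj x y}.

(* An edge is the two-element set of its ends. *)
Definition edges (G : sgraph) : {set {set G}} :=
  [set [set x; y] | x in G, y in G & adj x y].

Section Subgraph.
Variables (G : sgraph) (W : {set G}) (F : {set {set G}}).

Definition sub_vertex : finType := {x : G | x \in W}.

Definition sub_adj : rel sub_vertex :=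
  [rel x y | adj (val x) (val y) && ([set val x; val y] \in F)].

Lemma sub_adj_sym : symmetric sub_adj.
Proof. by move=> x y; rewrite /sub_adj /= adj_sym setUC. Qed.

Lemma sub_adj_irrefl : irreflexive sub_adj.
Proof. by move=> x; rewrite /sub_adj /= adj_irrefl. Qed.

(* The vertices are those in W and the edges are the edges of G that belong to
   F and have both ends in W.  Every subgraph of G is of this form. *)
Definition subgraph : sgraph := SGraph sub_adj_sym sub_adj_irrefl.

End Subgraph.

(* cover F is the set of all ends of the edges in F. *)
Definition edge_induced (G : sgraph) (F : {set {set G}}) : sgraph :=
  subgraph (cover F) F.

(* K is a subdivision of H with branch vertices f u.  For an edge uv of H,
   p u v lists the internal vertices, from f u to f v, of the path of K that
   replaces uv; it is empty when that path has length 1. *)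
Record subdivision_via (H K : sgraph) (f : H -> K) (p : H -> H -> seq K)
    : Prop := SubdivisionVia {
  branch_inj : injective f;
  path_rev : forall u v : H, adj u v -> p v u = rev (p u v);
  path_walk : forall u v : H, adj u v ->
    path (@adj K) (f u) (rcons (p u v) (f v));
  path_uniq : forall u v : H, adj u v -> uniq (f u :: rcons (p u v) (f v));
  path_avoid : forall u v w : H, adj u v -> f w \notin p u v;
  path_disjoint : forall (u v u' v' : H) (x : K), adj u v -> adj u' v' ->
    x \in p u v -> x \in p u' v' -> [set u; v] = [set u'; v'];
  vertex_covered : forall x : K,
    (exists u, x = f u) \/ (exists u v : H, adj u v /\ x \in p u v);
  edge_covered : forall x y : K, adj x y ->
    exists u v : H, adj u v /\ infix [:: x; y] (f u :: rcons (p u v) (f v)) }.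

Definition subdivision (H K : sgraph) : Prop :=
  exists f p, @subdivision_via H K f p.

Definition topological_minor (H G : sgraph) : Prop :=
  exists K (W : {set G}) (F : {set {set G}}),
    subdivision H K /\ isomorphic (subgraph W F) K.

Record ideal (C : graph_class) : Prop := Ideal {
  ideal_iso : forall G H, isomorphic G H -> C G -> C H;
  ideal_minor : forall G H, topological_minor H G -> C G -> C H }.

Definition forest (G : sgraph) : Prop :=
  ~ exists c : seq G, 3 <= size c /\ ucycle (@adj G) c.

Definition class_partition (C : graph_class) (G : sgraph)
    (P : {set {set {set G}}}) : Prop :=
  partition P (edges G) /\ forall F, F \in P -> C (edge_induced F).

Definition boundary (G : sgraph) (P : {set {set {set G}}}) : {set G} :=
  [set v | [exists F1 in P, exists F2 in P,
             [&& F1 != F2, v \in cover F1 & v \in cover F2]]].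

(* Since #|boundary P| <= #|G| for all P, the initial value #|G| does not affect
   the minimum as soon as an admissible partition exists.  This is so when C
   contains all forests, by taking every part to be a single edge. *)
Definition brittleness (C : graph_class) (G : sgraph) : nat :=
  \big[minn/#|G|]_(P : {set {set {set G}}} | `[< class_partition C P >])
     #|boundary P|.

Definition bounded_on (f : sgraph -> nat) (C : graph_class) : Prop :=
  exists M, forall G, C G -> f G <= M.

Section Fan.
Variables (G : sgraph) (S : {set G}) (k : nat).

(* inl v is the common copy of v \in S and inr (v, i) the i-th copy of
   v \notin S. *)
Definition fan_vertex : finType :=
  ({v : G | v \in S} + {v : G | v \notin S} * 'I_k)%type.

Definition fan_adj : rel fan_vertex := fun x y =>
  match x, y with
  | inl u, inl v => adj (val u) (val v)
  | inl u, inr (v, _) => adj (val u) (val v)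
  | inr (u, _), inl v => adj (val u) (val v)
  | inr (u, i), inr (v, j) => (i == j) && adj (val u) (val v)
  end.

Lemma fan_adj_sym : symmetric fan_adj.
Proof. by case=> [u|[u i]] [v|[v j]] /=; rewrite 1?[i == j]eq_sym adj_sym. Qed.

Lemma fan_adj_irrefl : irreflexive fan_adj.
Proof. by case=> [u|[u i]] /=; rewrite adj_irrefl ?andbF. Qed.

Definition fan : sgraph := SGraph fan_adj_sym fan_adj_irrefl.

End Fan.

Definition fan_ideal (G : sgraph) (S : {set G}) : graph_class := fun H =>
  exists k H', 0 < k /\ topological_minor H' (fan S k) /\ isomorphic H H'.

Section Complete.
Variable n : nat.

Definition complete_adj : rel 'I_n := fun x y => x != y.

Lemma complete_adj_sym : symmetric complete_adj.
Proof. by move=> x y; rewrite /complete_adj eq_sym. Qed.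

Lemma complete_adj_irrefl : irreflexive complete_adj.
Proof. by move=> x; rewrite /complete_adj eqxx. Qed.

Definition complete : sgraph := SGraph complete_adj_sym complete_adj_irrefl.

End Complete.

(* Main.v *)
Require Import Defs.
From mathcomp Require Import all_boot.
From mathcomp Require Import boolp zify.

Set Implicit Arguments.
Unset Strict Implicit.
Unset Printing Implicit Defensive.

(* If X meets every cycle in at least two vertices, then each X-bridge is a
   forest, so partitioning the edges into X-bridges bounds the brittleness by
   |X|.  To find X when no large fan occurs, take a bounded set Z hitting all
   cycles (Erdős–Pósa, as there are no k disjoint cycles) and, for each z in Z,
   a bounded set hitting all cycles of G - (Z \ z) outside z (there is no
   flower of cycles pairwise meeting in z).  Both hitting sets are obtained by
   deleting vertices of degree at most 1 and suppressing vertices of degree 2;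
   what remains has minimum degree 3 and, after the removal of short cycles,
   large girth, and large girth makes it contractible to a graph of large
   minimum degree, which contains many disjoint cycles.  Conversely, the
   boundary of a partition into forests contains two vertices of each triangle
   of a fan, hence one outside the common vertex.

   Graphs that are being reduced are pairs of a vertex set A and a relation e
   on a fixed finite type.  A cycle is represented by a "cyclic" vertex set,
   one that induces minimum degree at least 2. *)

(** * Cyclic sets and packings *)

Section CyclicSets.
Variable T : finType.
Implicit Types (e : rel T) (A B C R : {set T}) (s : seq {set T}).

Definition nbr e A x : {set T} := [set y in A | e x y].

Definition cyclic e B := (B != set0) && [forall x in B, 1 < #|nbr e B x|].

Definition arcs e B : {set T * T} := [set u in setX B B | e u.1 u.2].

Definition narcs e B := #|arcs e B|.

(** Arcs are ordered pairs, so for a symmetric [e] each edge counts twice and the condition asks for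
    at least as many edges as vertices. This is the form of containing a cycle that counting can
    establish. *)
Definition dense e B := (B != set0) && (2 * #|B| <= narcs e B).

Lemma cyclicP e B :
  reflect (B != set0 /\ {in B, forall x, 1 < #|nbr e B x|}) (cyclic e B).
Proof.
by apply: (iffP andP) => -[B0 degB]; split=> //; exact/forall_inP.
Qed.

Lemma sub_nbr e A B x : A \subset B -> nbr e A x \subset nbr e B x.
Proof.
by move/subsetP=> sAB; apply/subsetP=> y; rewrite !inE => /andP[/sAB-> ->].
Qed.

Lemma card_relX e B C :
  #|[set u in setX B C | e u.1 u.2]| = \sum_(x in B) #|nbr e C x|.
Proof.
rewrite -sum1_card; under [RHS]eq_bigr do rewrite -sum1_card.
rewrite pair_big_dep /=; apply: eq_bigl => -[x y].
by rewrite !inE /= andbA.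
Qed.

Lemma narcsE e B : narcs e B = \sum_(x in B) #|nbr e B x|.
Proof. exact: card_relX. Qed.

Lemma sub_arcs e B C : B \subset C -> arcs e B \subset arcs e C.
Proof.
move/subsetP=> sBC; apply/subsetP=> -[x y]; rewrite !inE /=.
by case/andP=> /andP[/sBC-> /sBC->] ->.
Qed.

Lemma cyclic_dense e B : cyclic e B -> dense e B.
Proof.
case/cyclicP=> B0 degB; rewrite /dense B0 narcsE mulnC -sum_nat_const.
by apply: leq_sum => x /degB.
Qed.

Lemma arcs_setD1 e B x : symmetric e ->
  narcs e B <= narcs e (B :\ x) + 2 * #|nbr e B x|.
Proof.
move=> e_sym; set N := nbr e B x.
have sub: arcs e B \subset
    arcs e (B :\ x) :|: ([set (x, y) | y in N] :|: [set (y, x) | y in N]).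
  apply/subsetP=> -[y z]; rewrite inE in_setX /= => /andP[/andP[yB zB] eyz].
  have [yx|yx] := eqVneq y x.
    apply/setUP; right; apply/setUP; left; apply/imsetP; exists z; last by rewrite yx.
    by rewrite inE zB -yx.
  have [zx|zx] := eqVneq z x.
    apply/setUP; right; apply/setUP; right; apply/imsetP; exists y; last by rewrite zx.
    by rewrite inE yB e_sym -zx.
  by apply/setUP; left; rewrite inE in_setX !in_setD1 /= yx yB zx zB.
apply: leq_trans (subset_leq_card sub) _.
apply: leq_trans (leq_card_setU _ _) _; rewrite leq_add2l mul2n -addnn.
by apply: leq_trans (leq_card_setU _ _) _; rewrite leq_add ?leq_imset_card.
Qed.

(** Deleting a vertex of degree at most 1 removes one vertex and at most one edge, so density
    survives; irreflexivity keeps the process from reaching a single vertex. *)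
Lemma dense_cyclic e B : symmetric e -> irreflexive e -> dense e B ->
  exists2 C, cyclic e C & C \subset B.
Proof.
move=> e_sym e_irr; have [n] := ubnP #|B|; elim: n B => // n IHn B ltBn dB.
have [cB|] := boolP (cyclic e B); first by exists B.
have /andP[B0 leB] := dB.
rewrite /cyclic B0 /= negb_forall_in => /exists_inP[x xB]; rewrite -leqNgt => degx.
have cBx := cardsD1 x B; rewrite xB in cBx.
have le1 := arcs_setD1 B x e_sym.
have [||C cC sC] := IHn (B :\ x).
- by move: ltBn; rewrite cBx.
- apply/andP; split; last by lia.
  apply/eqP=> Bx0; rewrite Bx0 cards0 in cBx.
  have /cards1P[y0 B1]: #|B| == 1 by rewrite cBx.
  suff: narcs e B = 0 by lia.
  apply/eqP; rewrite /narcs cards_eq0 -subset0; apply/subsetP=> -[y z].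
  by rewrite B1 !inE /= => /andP[/andP[/eqP-> /eqP->]]; rewrite e_irr.
by exists C => //; apply: subset_trans sC (subsetDl _ _).
Qed.

Lemma cyclic_card e B : irreflexive e -> cyclic e B -> 2 < #|B|.
Proof.
move=> e_irr /cyclicP[/set0Pn[x xB] /(_ x xB) lt1].
rewrite (cardsD1 x) xB ltnS; apply: leq_trans lt1 (subset_leq_card _).
apply/subsetP=> y; rewrite !inE => /andP[-> exy]; rewrite andbT.
by apply: contraTneq exy => ->; rewrite e_irr.
Qed.

Lemma cyclicD1 e A B v : #|nbr e A v| <= 1 -> B \subset A -> cyclic e B ->
  B \subset A :\ v.
Proof.
move=> degv sBA /cyclicP[_ degB]; rewrite subsetD1 sBA.
apply/negP=> /degB; rewrite ltnNge => /negP; apply.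
exact: leq_trans (subset_leq_card (sub_nbr _ _ sBA)) degv.
Qed.

Lemma cyclic3 e x y z : symmetric e -> irreflexive e ->
  e x y -> e y z -> e z x -> cyclic e [set x; y; z].
Proof.
move=> e_sym e_irr exy eyz ezx.
have ne a b : e a b -> a != b by apply: contraTneq => ->; rewrite e_irr.
apply/cyclicP; split; first by apply/set0Pn; exists x; rewrite !inE eqxx.
have deg u a b : a \in [set x; y; z] -> b \in [set x; y; z] -> a != b ->
    e u a -> e u b -> 1 < #|nbr e [set x; y; z] u|.
  move=> aS bS ab eua eub.
  have <-: #|[set a; b]| = 2 by rewrite cards2 ab.
  apply: subset_leq_card; apply/subsetP=> w; rewrite inE [w \in nbr _ _ _]inE.
  by case/orP=> /set1P->; rewrite ?aS ?bS.
move=> u; rewrite [u \in _]inE [u \in _ :|: _]inE => /orP[/orP[]|] /set1P->.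
- by apply: (@deg _ y z); rewrite ?inE ?eqxx ?orbT ?ne // e_sym.
- by apply: (@deg _ x z); rewrite ?inE ?eqxx ?orbT ?ne // 1?e_sym.
- by apply: (@deg _ x y); rewrite ?inE ?eqxx ?orbT ?ne // e_sym.
Qed.

(** [R] is what two members may share: [set0] for disjoint cycles, [[set z]] for cycles that meet at
    most in [z]. *)
Definition packing e A R s :=
  all (fun B => cyclic e B && (B \subset A)) s
  && pairwise (fun B C => B :&: C \subset R) s.

Lemma packing_cons e A R B s : packing e A R (B :: s) =
  [&& cyclic e B && (B \subset A), all (fun C => B :&: C \subset R) s
    & packing e A R s].
Proof.
rewrite /packing /= -!andbA; do 2!congr (_ && _).
by case: all; case: pairwise; case: all.
Qed.

Lemma packing_sub e A A' R s : A' \subset A -> packing e A' R s ->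
  packing e A R s.
Proof.
move=> sA /andP[s1 s2]; rewrite /packing s2 andbT.
apply: sub_all s1 => B /andP[-> sB]; exact: subset_trans sB sA.
Qed.

Lemma packing_extend e A A' R B s : packing e A' R s -> A' \subset A ->
  cyclic e B -> B \subset A -> B :&: A' \subset R -> packing e A R (B :: s).
Proof.
move=> s_pack sA cB sBA BA'R.
rewrite packing_cons cB sBA (packing_sub sA s_pack) /= andbT.
case/andP: s_pack => s1 _; apply: sub_all s1 => C /andP[_ sC].
by apply: subset_trans (setIS B sC) BA'R.
Qed.

(** Here [g B] is the room allotted to the set that replaces [B]. The induction also records that
    each new set lies in the room of an old one, which passes on the pairwise condition. *)
Lemma packing_transfer e e' A A' R s (g : {set T} -> {set T}) :
    (forall B, cyclic e' B -> B \subset A' ->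
       exists2 C, cyclic e C & (C \subset A) && (C \subset g B)) ->
    (forall B C, B :&: C \subset R -> g B :&: g C \subset R) ->
    packing e' A' R s ->
  exists2 s', size s' = size s & packing e A R s'.
Proof.
move=> lift gR /andP[s1 s2].
suff [s' sz [ps' s's]]: exists2 s', size s' = size s & packing e A R s' /\
    all (fun C => has (fun B => C \subset g B) s) s' by exists s'.
elim: s s1 s2 => [|B s IHs] /= => [_ _|]; first by exists [::].
case/andP=> /andP[cB sB] s1 /andP[Bs s2].
have [s' sz [ps' s's]] := IHs s1 s2.
have [C cC /andP[sCA sCg]] := lift B cB sB.
exists (C :: s') => /=; rewrite ?sz // sCg /=; split.
  rewrite packing_cons cC sCA ps' /= andbT; apply: sub_all s's => D.
  case/hasP=> B' B's sD; apply: subset_trans (setISS sCg sD) _.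
  by apply/gR/(allP Bs).
by apply: sub_all s's => D ->; rewrite orbT.
Qed.

(** * Disjoint cycles from large minimum degree *)

Lemma card_nbrU e A B x : #|nbr e (A :|: B) x| <= #|nbr e A x| + #|nbr e B x|.
Proof.
apply: leq_trans _ (leq_card_setU (nbr e A x) (nbr e B x)).
apply: subset_leq_card.
by apply/subsetP=> y; rewrite !inE andb_orl.
Qed.

Lemma arcs_setU1 e B v : symmetric e -> v \notin B ->
  narcs e B + 2 * #|nbr e B v| <= narcs e (v |: B).
Proof.
move=> e_sym vB; set N := nbr e B v.
have sub: arcs e B :|: ([set (v, y) | y in N] :|: [set (y, v) | y in N])
    \subset arcs e (v |: B).
  rewrite !subUset sub_arcs ?subsetUr //=.
  by apply/andP; split; apply/subsetP=> _ /imsetP[y + ->];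
     rewrite !inE /= eqxx ?(e_sym y) => /andP[-> ->]; rewrite ?orbT.
apply: leq_trans (subset_leq_card sub).
have disj1 : [set (v, y) | y in N] :&: [set (y, v) | y in N] = set0.
  apply/setP=> -[y z]; rewrite in_setI in_set0; apply/negbTE/negP.
  case/andP=> /imsetP[w wN [_ zw]] /imsetP[w' _ [_ zv]].
  by move: wN; rewrite inE -zw zv (negPf vB).
have disj2 : arcs e B :&: ([set (v, y) | y in N] :|: [set (y, v) | y in N]) = set0.
  apply/setP=> -[y z]; rewrite in_setI in_set0; apply/negbTE/negP.
  rewrite in_setU inE in_setX /= => /andP[/andP[/andP[yB zB] _]].
  case/orP=> /imsetP[w _ [yw zw]].
    by rewrite yw (negPf vB) in yB.
  by rewrite zw (negPf vB) in zB.
rewrite cardsU disj2 cardsU disj1 cards0 !subn0.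
by rewrite !card_imset ?mul2n ?addnn // => y z [].
Qed.

Lemma dense_min e A : symmetric e -> irreflexive e -> dense e A ->
  exists C, [/\ dense e C, C \subset A &
    forall D, dense e D -> D \subset A -> #|C| <= #|D|].
Proof.
move=> e_sym e_irr dA.
have P0 : dense e A && (A \subset A) by rewrite dA subxx.
pose P (C : {set T}) := dense e C && (C \subset A).
case: (@arg_minnP _ A P (fun C : {set T} => #|C|) P0) => C /andP[dC sC] minC.
by exists C; split=> // D dD sD; apply: minC; rewrite /P dD sD.
Qed.

(* In a smallest set C spanning at least |C| edges all degrees are at most 5;
   if an outside vertex v had 11 neighbours in C, then v + C minus any two
   vertices of C would be a smaller such set. *)
Lemma dense_few_nbrs e A : symmetric e -> irreflexive e -> dense e A ->
  exists C, [/\ dense e C, C \subset A & forall v, v \in A -> #|nbr e C v| <= 10].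
Proof.
move=> e_sym e_irr dA; have [C [dC sC minC]] := dense_min e_sym e_irr dA.
exists C; split=> //.
have n3 : 2 < #|C|.
  have [B cB sB] := dense_cyclic e_sym e_irr dC.
  exact: leq_trans (cyclic_card e_irr cB) (subset_leq_card sB).
have /andP[_ leC] := dC.
have small (D : {set T}) : D \subset A -> 0 < #|D| -> #|D| < #|C| -> narcs e D < 2 * #|D|.
  move=> sD D0 ltD; rewrite ltnNge; apply: contraTN ltD => leD.
  by rewrite -leqNgt minC // /dense leD -card_gt0 D0.
(* By minimality [C :\ x] is not dense. *)
have degC x : x \in C -> narcs e C + 3 <= 2 * #|C| + 2 * #|nbr e C x|.
  move=> xC; have := arcs_setD1 C x e_sym; have := cardsD1 x C; rewrite xC.
  have := small (C :\ x) (subset_trans (subsetDl _ _) sC); lia.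
(* Summing [degC] over [C], with [n] vertices and [a] arcs, gives [n (a + 3) <= 2 n^2 + 2 a]; as
   [n > 2], this yields [a <= 2 n + 3]. *)
have aC : narcs e C <= 2 * #|C| + 3.
  have: \sum_(x in C) (narcs e C + 3) <= \sum_(x in C) (2 * #|C| + 2 * #|nbr e C x|).
    exact: leq_sum.
  rewrite !big_split /= !sum_nat_const -!narcsE.
  move: #|C| (narcs e C) n3 leC => n a; nia.
(* All other degrees are at least 2 by [degC], which leaves at most [2 n + 3 - 2 (n - 1) = 5] for
   [x]. *)
have deg5 x : x \in C -> #|nbr e C x| <= 5.
  move=> xC; have := narcsE e C; rewrite (bigD1 x) //=.
  have: \sum_(y in C | y != x) 2 <= \sum_(y in C | y != x) #|nbr e C y|.
    by apply: leq_sum => y /andP[/degC]; lia.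
  rewrite sum_nat_const; have -> : #|[pred y in C | y != x]| = #|C :\ x|.
    by apply: eq_card => y; rewrite !inE andbC.
  have := cardsD1 x C; rewrite xC; lia.
move=> v vA; have [vC|vC] := boolP (v \in C); first by have := deg5 v vC; lia.
rewrite leqNgt; apply/negP=> lt10.
have [x xC] : exists x, x \in C by apply/set0Pn; rewrite -card_gt0; lia.
have [y yC] : exists y, y \in C :\ x.
  by apply/set0Pn; rewrite -card_gt0; have := cardsD1 x C; rewrite xC; lia.
have deg6 w : w \in C -> #|nbr e (v |: C) w| <= 6.
  move=> /deg5 le5; apply: leq_trans (card_nbrU _ _ _ _) _.
  suff: #|nbr e [set v] w| <= 1 by lia.
  rewrite -(cards1 v); apply/subset_leq_card/subsetP=> z.
  by rewrite [z \in nbr _ _ _]inE => /andP[].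
have yC' : y \in C by move: yC; rewrite inE => /andP[].
have yx : y != x by move: yC; rewrite !inE => /andP[].
set D := (v |: C) :\ x :\ y.
(* Adding [v] gains at least 22 arcs and deleting [x] and [y] loses at most 12 each. As [D] has one
   vertex fewer than [C], the net loss of 2 leaves it dense. *)
have aD : narcs e C + 22 <= narcs e D + 24.
  have := arcs_setU1 e_sym vC; have := deg6 x xC; have := deg6 y yC'.
  have := arcs_setD1 (v |: C) x e_sym; have := arcs_setD1 ((v |: C) :\ x) y e_sym.
  have: #|nbr e ((v |: C) :\ x) y| <= #|nbr e (v |: C) y|.
    by apply/subset_leq_card/sub_nbr/subsetDl.
  rewrite -/D; lia.
have cD : #|D|.+1 = #|C|.
  have := cardsU1 v C; rewrite vC /=; have := cardsD1 x (v |: C).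
  have := cardsD1 y ((v |: C) :\ x); rewrite -/D !inE xC yC' yx !orbT /=; lia.
have sD : D \subset A.
  apply: subset_trans (subset_trans (subsetDl _ _) (subsetDl _ _)) _.
  by rewrite subUset sub1set vA.
have := small D sD; lia.
Qed.

(** A cycle is taken inside a set [C] from [dense_few_nbrs] and all of [C] is deleted. Every vertex
    loses at most 10 neighbours, and [11 * k.+1 - 10 > 11 * k]. *)
Lemma min_degree_packing k e A : symmetric e -> irreflexive e -> A != set0 ->
  {in A, forall x, 11 * k <= #|nbr e A x|} ->
  exists2 s, size s = k & packing e A set0 s.
Proof.
move=> e_sym e_irr; elim: k A => [|k IHk] A A0 degA; first by exists [::].
have cA : cyclic e A by apply/cyclicP; split=> // x /degA; lia.
have [C [dC sC degC]] := dense_few_nbrs e_sym e_irr (cyclic_dense cA).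
have [B cB sB] := dense_cyclic e_sym e_irr dC.
have degAC x : x \in A -> 11 * k < #|nbr e (A :\: C) x|.
  move=> xA; have := degA x xA; have := degC x xA.
  have {1}<- : (A :\: C) :|: C = A.
    apply/setP=> y; rewrite !inE.
    by case: (boolP (y \in C)) => [/(subsetP sC)->|]; rewrite ?orbF.
  have := card_nbrU e (A :\: C) C x; lia.
have [|x|s sz ps] := IHk (A :\: C).
- case/set0Pn: A0 => x /degAC lt_x; apply/set0Pn.
  have /card_gt0P[y] : 0 < #|nbr e (A :\: C) x| by lia.
  by rewrite inE => /andP[yAC _]; exists y.
- by rewrite inE => /andP[_ /degAC/ltnW].
exists (B :: s); rewrite /= ?sz //.
apply: packing_extend ps (subsetDl _ _) cB (subset_trans sB sC) _.
by rewrite setIDA setIC -setIDA (_ : B :\: C = set0) ?setI0 //; apply/eqP; rewrite setD_eq0.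
Qed.

End CyclicSets.

(** * Contraction and girth *)

(** Dense sets stand in for cycles: the contraction arguments below exhibit short cycles by counting
    arcs. *)
Definition girth_gt (T : finType) (e : rel T) (A : {set T}) L :=
  forall B, dense e B -> B \subset A -> L < #|B|.

Section Contraction.
Variables (T : finType) (e : rel T) (A M : {set T}) (p : T -> T).
Hypotheses (e_sym : symmetric e) (e_irr : irreflexive e) (MA : M \subset A).
Hypothesis (p_in : {in A, forall x, p x \in A}).
Hypothesis (p_root : {in M, forall x, p x = x}).
Hypothesis (p_adj : forall x, x \in A -> x \notin M -> e x (p x)).
Hypothesis (pp_root : {in A, forall x, p (p x) \in M}).

(** [p] is the parent map of a spanning forest of depth at most two with root set [M], roots being
    fixed; so [c x] is the root of the tree of [x], and [contraction] is the quotient graph on the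
    roots. *)
Let c x := p (p x).

Definition contraction : rel T := fun m m' =>
  (m != m') && [exists x in A, exists y in A, [&& e x y, c x == m & c y == m']].

Lemma contraction_sym : symmetric contraction.
Proof.
suff imp m m' : contraction m m' -> contraction m' m.
  by move=> m m'; apply/idP/idP; exact: imp.
case/andP=> ne /exists_inP[x xA /exists_inP[y yA /and3P[exy cx cy]]].
rewrite /contraction eq_sym ne; apply/exists_inP; exists y => //.
by apply/exists_inP; exists x; rewrite // e_sym exy cx cy.
Qed.

Lemma contraction_irr : irreflexive contraction.
Proof. by move=> m; rewrite /contraction eqxx. Qed.

Lemma c_p x : x \in A -> c (p x) = c x.
Proof. by move=> xA; rewrite /c p_root ?pp_root. Qed.

Lemma c_root m : m \in M -> c m = m.
Proof. by move=> mM; rewrite /c !p_root. Qed.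

Lemma c_in x : x \in A -> c x \in M.
Proof. exact: pp_root. Qed.

(** The closure of [X] under parents: each vertex brings its path to the root, whence the factor 3
    in [hull_card]. *)
Definition hull X := X :|: p @: X :|: c @: X.

Lemma hull_sub (X : {set T}) : X \subset A -> hull X \subset A.
Proof.
move/subsetP=> sXA; rewrite !subUset; apply/andP; split; [apply/andP; split|].
- exact/subsetP.
- by apply/subsetP=> _ /imsetP[x /sXA xA ->]; exact: p_in.
- by apply/subsetP=> _ /imsetP[x /sXA xA ->]; apply/p_in/p_in.
Qed.

Lemma hull_closed (X : {set T}) : X \subset A -> {in hull X, forall x, p x \in hull X}.
Proof.
move=> /subsetP sXA x; rewrite !inE => /orP[/orP[xX|/imsetP[y yX ->]]|/imsetP[y yX ->]].
- by rewrite (imset_f p xX) orbT.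
- by rewrite (imset_f c yX) orbT.
- by rewrite p_root ?c_in ?sXA // (imset_f c yX) orbT.
Qed.

Lemma hull_card (X : {set T}) : #|hull X| <= 3 * #|X|.
Proof.
have := leq_card_setU (X :|: p @: X) (c @: X).
have := leq_card_setU X (p @: X) => -[+ _] [+ _].
have := leq_imset_card p X; have := leq_imset_card c X; rewrite /hull; lia.
Qed.

Lemma hull_root (X : {set T}) : X \subset A -> hull X :&: M \subset c @: X.
Proof.
move=> /subsetP sXA; apply/subsetP=> x; rewrite !inE => /andP[+ xM].
case/orP=> [/orP[xX|/imsetP[y yX xy]]|//].
  by apply/imsetP; exists x; rewrite ?c_root.
by apply/imsetP; exists y; rewrite // /c -xy p_root.
Qed.

Definition nontree B :=
  [set u in arcs e B | (p u.1 != u.2) && (p u.2 != u.1)].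

(** Each non-root contributes the edge to its parent, as two arcs. These arcs are all distinct,
    since [p (p x) = x] would make [x] a root. *)
Lemma closed_arcs (B : {set T}) : B \subset A -> {in B, forall x, p x \in B} ->
  2 * #|B :\: M| + #|nontree B| <= narcs e B.
Proof.
move=> /subsetP sBA clB.
have root x : x \in B -> x \notin M -> p (p x) != x.
  by move=> xB; apply: contraNneq => {1}<-; rewrite c_in ?sBA.
set up := [set (x, p x) | x in B :\: M].
set dn := [set (p x, x) | x in B :\: M].
have sub : nontree B :|: (up :|: dn) \subset arcs e B.
  rewrite !subUset; apply/and3P; split.
  - by apply/subsetP=> u; rewrite inE => /andP[].
  - apply/subsetP=> _ /imsetP[x + ->]; rewrite inE => /andP[xM xB].
    by rewrite inE in_setX /= xB clB // p_adj ?sBA.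
  - apply/subsetP=> _ /imsetP[x + ->]; rewrite inE => /andP[xM xB].
    by rewrite inE in_setX /= xB clB // e_sym p_adj ?sBA.
have disj1 : up :&: dn = set0.
  apply/setP=> -[y z]; rewrite in_setI in_set0; apply/negbTE/negP.
  case/andP=> /imsetP[x + [yx zx]] /imsetP[x' _ [yx' zx']].
  rewrite inE => /andP[xM xB].
  by have := root x xB xM; rewrite -zx zx' -yx' yx eqxx.
have disj2 : nontree B :&: (up :|: dn) = set0.
  apply/setP=> -[y z]; rewrite in_setI in_set0; apply/negbTE/negP.
  rewrite inE in_setU /= => /andP[/andP[_ /andP[yz zy]]].
  case/orP=> /imsetP[x _ [yx zx]].
    by rewrite yx zx eqxx in yz.
  by rewrite yx zx eqxx in zy.
have cup : #|up| = #|B :\: M| by rewrite card_in_imset // => x y _ _ [].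
have cdn : #|dn| = #|B :\: M| by rewrite card_in_imset // => x y _ _ [].
apply: leq_trans (subset_leq_card sub).
by rewrite cardsU disj2 cardsU disj1 cards0 !subn0 cup cdn addnC mul2n addnn.
Qed.

(** The forest on the hull has as many edges as non-roots; [r] edges outside the forest make up for
    at most [r] roots. *)
Lemma hull_dense (X : {set T}) r : X \subset A -> 0 < #|X| ->
  #|c @: X| <= r -> 2 * r <= #|nontree (hull X)| -> dense e (hull X).
Proof.
move=> sXA X0 cX ntX; apply/andP; split.
  by rewrite -card_gt0; apply: leq_trans X0 (subset_leq_card _); rewrite /hull -setUA subsetUl.
have := closed_arcs (hull_sub sXA) (hull_closed sXA).
have := cardsID M (hull X); have := subset_leq_card (hull_root sXA); lia.
Qed.

Lemma nontree_mem (X : {set T}) x y : x \in X -> y \in X -> e x y ->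
  p x != y -> p y != x -> (x, y) \in nontree (hull X).
Proof.
move=> xX yX exy pxy pyx.
by rewrite inE [_ \in arcs _ _]inE in_setX !in_setU /= xX yX exy pxy pyx.
Qed.

Lemma nontree_c x y : x \in A -> y \in A -> c x != c y -> (p x != y) /\ (p y != x).
Proof.
move=> xA yA cxy; split; first by apply: contraNneq cxy => <-; rewrite c_p.
by apply: contraNneq cxy => <-; rewrite c_p.
Qed.

(** Two edges have at most four ends, and the hull of these has at most 12 vertices. *)
Hypothesis girth12 : girth_gt e A 12.

(** An edge outside the forest with both ends in one tree would close a cycle in the hull of its
    ends, which has one root and at most 6 vertices. *)
Lemma part_tree x y : x \in A -> y \in A -> e x y -> c x = c y ->
  (p x == y) || (p y == x).
Proof.
move=> xA yA exy cxy; rewrite -[_ || _]negbK negb_or; apply/negP=> /andP[pxy pyx].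
set X := [set x; y].
have sXA : X \subset A by rewrite subUset !sub1set xA.
have [xX yX] : x \in X /\ y \in X by rewrite !inE !eqxx orbT.
have cX : #|X| <= 2 by rewrite cards2; case: eqP.
have : dense e (hull X).
  apply: (@hull_dense _ 1) => //.
  - by apply/card_gt0P; exists x.
  - by rewrite imsetU1 imset_set1 cxy setUid cards1.
  have xy : x != y by apply: contraTneq exy => ->; rewrite e_irr.
  rewrite -[2 * 1]/(true.+1) -(_ : ((x, y) != (y, x)) = true); last first.
    by rewrite xpair_eqE (negPf xy).
  rewrite -cards2; apply/subset_leq_card; rewrite subUset !sub1set.
  by rewrite !nontree_mem // e_sym.
by move/girth12/(_ (hull_sub sXA)); have := hull_card X; lia.
Qed.

(** Two edges between the same two trees would close a cycle in the hull of their ends, which has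
    two roots and at most 12 vertices. *)
Lemma parts_simple x y x' y' :
    x \in A -> y \in A -> x' \in A -> y' \in A -> e x y -> e x' y' ->
    c x = c x' -> c y = c y' -> c x != c y ->
  (x, y) = (x', y').
Proof.
move=> xA yA xA' yA' exy exy' cx cy cxy; apply/eqP; apply/negPn/negP => ne.
set X := [set x; y] :|: [set x'; y'].
have sXA : X \subset A by rewrite !subUset !sub1set xA yA xA' yA'.
have [xX yX xX' yX'] : [/\ x \in X, y \in X, x' \in X & y' \in X].
  by rewrite !inE !eqxx !orbT.
have cX : #|X| <= 4.
  have c2 (a b : T) : #|[set a; b]| <= 2 by rewrite cards2; case: eqP.
  apply: leq_trans (leq_add (c2 x y) (c2 x' y')).
  exact: leq_card_setU.
have : dense e (hull X).
  apply: (@hull_dense _ 2) => //.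
  - by apply/card_gt0P; exists x.
  - rewrite imsetU !imsetU1 !imset_set1 -cx -cy setUid cards2.
    by case: (_ != _).
  have [pxy pyx] := nontree_c xA yA cxy.
  have [pxy' pyx'] : (p x' != y') /\ (p y' != x') by apply: nontree_c; rewrite // -cx -cy.
  have ne1 u v u' v' : c u != c u' -> (u, v) != (u', v').
    by apply: contraNneq => -[->].
  have -> : 2 * 2 = #|[set (x, y); (x', y')] :|: [set (y, x); (y', x')]|.
    rewrite cardsU disjoint_setI0.
      rewrite cards0 subn0 !cards2 ne (_ : (y, x) != (y', x')) //.
      by move: ne; rewrite !xpair_eqE andbC.
    rewrite -setI_eq0; apply/eqP/setP=> u; rewrite !inE.
    apply/negbTE/negP=> /andP[u1 u2].
    have c1 : c u.1 = c x by case/orP: u1 => /eqP->.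
    have c2 : c u.1 = c y by case/orP: u2 => /eqP->.
    by rewrite -c1 c2 eqxx in cxy.
  apply/subset_leq_card; rewrite !subUset !sub1set.
  by rewrite !nontree_mem // e_sym.
move/girth12/(_ (hull_sub sXA)); rewrite ltnNge.
by rewrite (leq_trans (hull_card X)) ?(leq_mul (leqnn 3) cX).
Qed.

Lemma lift_exists : exists f : T * T -> T * T, forall u, contraction u.1 u.2 ->
  [/\ (f u).1 \in A, (f u).2 \in A, e (f u).1 (f u).2,
      c (f u).1 = u.1 & c (f u).2 = u.2].
Proof.
pose P u v := [&& v.1 \in A, v.2 \in A, e v.1 v.2, c v.1 == u.1 & c v.2 == u.2].
exists (fun u => odflt u [pick v | P u v]) => u.
case/andP=> _ /exists_inP[x xA /exists_inP[y yA /and3P[exy cx cy]]].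
case: pickP => [v /and5P[? ? ? /eqP ? /eqP ?] //|/(_ (x, y))].
by rewrite /P /= xA yA exy cx cy.
Qed.

(** From a dense [B] exactly [2 * #|B|] arcs are kept and lifted to arcs of [e]. Their at most
    [4 * #|B|] ends have a hull of at most [12 * #|B|] vertices with all roots in [B], so the hull
    is dense. *)
Lemma contraction_girth L : girth_gt e A (12 * L) -> girth_gt contraction M L.
Proof.
move=> gL B /andP[B0 leB] sBM.
have /card_geqP[s [s_uniq sz_s sub_s]] := leB.
pose Q : {set T * T} := [set u in s].
have cQ : #|Q| = 2 * #|B| by rewrite cardsE (card_uniqP s_uniq).
have QB u : u \in Q -> [/\ u.1 \in B, u.2 \in B & contraction u.1 u.2].
  by case: u => u1 u2; rewrite inE => /sub_s; rewrite inE in_setX => /andP[/andP[]].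
have [f fP] := lift_exists.
set X := [set (f u).1 | u in Q] :|: [set (f u).2 | u in Q].
have XP x : x \in X -> x \in A /\ c x \in B.
  by rewrite inE => /orP[] /imsetP[u /QB[u1 u2 /fP[? ? _ c1 c2]] ->]; rewrite ?c1 ?c2.
have sXA : X \subset A by apply/subsetP=> x /XP[].
have cX : #|X| <= 4 * #|B|.
  apply: (@leq_trans (#|Q| + #|Q|)); last by rewrite cQ; lia.
  by apply: leq_trans (leq_card_setU _ _) _; rewrite leq_add ?leq_imset_card.
have B_gt0 : 0 < #|B| by rewrite card_gt0.
have [u0 u0Q] : exists u, u \in Q by apply/card_gt0P; lia.
have : dense e (hull X).
  apply: (@hull_dense _ #|B|) => //.
  - by apply/card_gt0P; exists (f u0).1; apply/setUP; left; exact: (imset_f (fun u => (f u).1)).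
  - by apply: subset_leq_card; apply/subsetP=> _ /imsetP[x /XP[_ ?] ->].
  have f_inj : {in Q &, injective f}.
    move=> [u1 u2] [v1 v2] /QB[_ _ /fP[_ _ _ /= a1 a2]] /QB[_ _ /fP[_ _ _ /= b1 b2]].
    by move=> ff; rewrite -ff in b1 b2; rewrite -(etrans (esym a1) b1) -(etrans (esym a2) b2).
  rewrite -cQ -(card_in_imset f_inj); apply/subset_leq_card/subsetP=> _ /imsetP[u uQ ->].
  have [_ _ cu] := QB u uQ; have [u1A u2A eu c1 c2] := fP u cu.
  have [] := @nontree_c (f u).1 (f u).2 => //; first by rewrite c1 c2; case/andP: cu.
  move=> p1 p2; rewrite [f u]surjective_pairing nontree_mem //; apply/setUP.
    by left; exact: (imset_f (fun u => (f u).1)).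
  by right; exact: (imset_f (fun u => (f u).2)).
by move/gL/(_ (hull_sub sXA)); have := hull_card X; lia.
Qed.

(** The union of the trees rooted in a cyclic set is dense, by the forest edges and one lifted edge
    for each edge of the contraction. Disjoint root sets have disjoint unions of trees. *)
Lemma contraction_packing s : packing contraction M set0 s ->
  exists2 s', size s' = size s & packing e A set0 s'.
Proof.
apply: (@packing_transfer _ _ _ _ _ _ _ (fun B => [set x in A | c x \in B])); last first.
  move=> B C /subsetP dBC; apply/subsetP=> x; rewrite !inE => /andP[/andP[_ xB] /andP[_ xC]].
  by have := dBC (c x); rewrite !inE xB xC => /(_ isT).
move=> B cB /subsetP sBM; set D := [set x in A | c x \in B].
have sDA : D \subset A by apply/subsetP=> x; rewrite inE => /andP[].
suff dD : dense e D.
  by have [C cC sC] := dense_cyclic e_sym e_irr dD; exists C; rewrite // sC (subset_trans sC).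
have sBD : B \subset D.
  by apply/subsetP=> x xB; rewrite inE c_root ?xB ?sBM // (subsetP MA) ?sBM.
have /andP[B0 leB] := cyclic_dense cB.
apply/andP; split.
  by apply: contra_neq B0 => D0; apply/eqP; rewrite -subset0 -D0.
have clD : {in D, forall x, p x \in D}.
  by move=> x; rewrite !inE => /andP[xA xB]; rewrite p_in // c_p.
have := closed_arcs sDA clD; have := cardsID M D.
have : #|D :&: M| <= #|B|.
  apply/subset_leq_card/subsetP=> x; rewrite !inE => /andP[/andP[_ xB] xM].
  by rewrite -(c_root xM).
suff : narcs contraction B <= #|nontree D| by lia.
have [f fP] := lift_exists.
have BP u : u \in arcs contraction B -> [/\ u.1 \in B, u.2 \in B & contraction u.1 u.2].
  by case: u => u1 u2; rewrite inE in_setX => /andP[/andP[]].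
have f_inj : {in arcs contraction B &, injective f}.
  move=> [u1 u2] [v1 v2] /BP[_ _ /fP[_ _ _ /= a1 a2]] /BP[_ _ /fP[_ _ _ /= b1 b2]].
  by move=> ff; rewrite -ff in b1 b2; rewrite -(etrans (esym a1) b1) -(etrans (esym a2) b2).
rewrite /narcs -(card_in_imset f_inj); apply/subset_leq_card/subsetP=> _ /imsetP[u uB ->].
have [u1B u2B cu] := BP u uB; have [u1A u2A eu c1 c2] := fP u cu.
have [] := @nontree_c (f u).1 (f u).2 => //; first by rewrite c1 c2; case/andP: cu.
move=> p1 p2; rewrite [f u]surjective_pairing inE [_ \in arcs _ _]inE in_setX !inE /=.
by rewrite u1A u2A c1 c2 u1B u2B eu p1 p2.
Qed.

Hypothesis (p_star : forall m x, m \in M -> x \in A -> e m x -> p x = m).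

(** The tree [P] of [m] contains [m] and all its neighbours, so it has more than [d] vertices, and
    by [part_tree] it spans at most [#|P| - 1] edges. By [parts_simple] the edges leaving [P] go to
    distinct trees. *)
Lemma contraction_degree d : 2 < d -> {in A, forall x, d <= #|nbr e A x|} ->
  {in M, forall m, d < #|nbr contraction M m|}.
Proof.
move=> d3 degA m mM; have mA := subsetP MA m mM.
set P := [set x in A | c x == m].
have mP : m \in P by rewrite inE mA c_root /=.
have sPA : P \subset A by apply/subsetP=> x; rewrite inE => /andP[].
have PP z : z \in P -> z \in A /\ c z = m by rewrite inE => /andP[-> /eqP].
have d_lt_P : d < #|P|.
  apply: leq_ltn_trans (degA m mA) _; have := cardsD1 m P; rewrite mP add1n => ->.
  apply/subset_leq_card/subsetP=> x; rewrite inE => /andP[xA emx].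
  rewrite !inE xA /c (p_star mM xA emx) p_root // eqxx !andbT.
  by apply: contraTneq emx => ->; rewrite e_irr.
have aP : narcs e P + 2 <= 2 * #|P|.
  suff : narcs e P <= 2 * #|P :\ m| by have := cardsD1 m P; rewrite mP; lia.
  have : arcs e P \subset [set (x, p x) | x in P :\ m] :|: [set (p x, x) | x in P :\ m].
    apply/subsetP=> -[x y]; rewrite inE in_setX /= => /andP[/andP[xP yP] exy].
    have [[xA cx] [yA cy]] := (PP x xP, PP y yP).
    have nem z w : e z w -> p z = w -> z != m.
      by move=> + pz; apply: contraTneq => zm; rewrite -pz zm p_root // e_irr.
    have /orP[/eqP pxy|/eqP pxy] := part_tree xA yA exy (etrans cx (esym cy)).
      apply/setUP; left; apply/imsetP; exists x; last by rewrite pxy.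
      by rewrite in_setD1 xP (nem x y).
    apply/setUP; right; apply/imsetP; exists y; last by rewrite pxy.
    by rewrite in_setD1 yP (nem y x) // e_sym.
  move/subset_leq_card => le1; apply: leq_trans le1 _.
  apply: leq_trans (leq_card_setU _ _) _.
  by rewrite mul2n -addnn leq_add ?leq_imset_card.
set O := [set u in setX P (A :\: P) | e u.1 u.2].
have degO : d * #|P| <= #|O| + narcs e P.
  rewrite card_relX narcsE -big_split /= mulnC -sum_nat_const.
  apply: leq_sum => x xP; apply: leq_trans (degA x (subsetP sPA x xP)) _.
  rewrite addnC; apply: leq_trans (card_nbrU _ _ _ _); apply/subset_leq_card/sub_nbr.
  by apply/subsetP=> y; rewrite !inE => ->; case: (_ == _).
(* At least [(d - 2) * #|P| + 2] edges leave [P]; this exceeds [d] because [#|P| > d > 2]. *)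
suff : #|O| <= #|nbr contraction M m| by nia.
have OP u : u \in O -> [/\ u.1 \in A, u.2 \in A, c u.1 = m, c u.2 != m & e u.1 u.2].
  case: u => x y; rewrite inE in_setX !inE /=.
  case/andP=> /andP[/andP[-> /eqP->] /andP[+ yA]] ->.
  by rewrite yA /=.
have c_inj : {in O &, injective (fun u => c u.2)}.
  move=> [x y] [x' y'] /OP[/= xA yA cx cy exy] /OP[/= xA' yA' cx' cy' exy'] cyy.
  by apply: parts_simple; rewrite // ?cx ?cx' // eq_sym.
rewrite -(card_in_imset c_inj); apply/subset_leq_card/subsetP.
move=> _ /imsetP[u /OP[xA yA cx cy exy] ->].
rewrite inE c_in // /contraction eq_sym cy /=.
apply/exists_inP; exists u.1 => //; apply/exists_inP; exists u.2 => //.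
by rewrite exy cx !eqxx.
Qed.

End Contraction.

(** [M] is a maximal set of vertices of [A] that are pairwise non-adjacent without common neighbours
    in [A]. Maximality puts every vertex of [A] within distance two of [M], and an adjacent root is
    unique. *)
Lemma packed_roots (T : finType) (e : rel T) (A : {set T}) :
  symmetric e -> exists (M : {set T}) (p : T -> T),
  [/\ M \subset A, {in A, forall x, p x \in A}, {in M, forall x, p x = x} &
     (forall x, x \in A -> x \notin M -> e x (p x))] /\
  ({in A, forall x, p (p x) \in M} /\
   (forall m x, m \in M -> x \in A -> e m x -> p x = m)).
Proof.
move=> e_sym.
pose far (M : {set T}) := (M \subset A) && [forall m in M, forall m' in M,
  (m != m') ==> ~~ e m m' && [forall x in A, ~~ (e m x && e m' x)]].
have far0 : far set0.
  by rewrite /far sub0set; apply/forall_inP=> m; rewrite inE.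
have [M /maxsetP[/andP[MA farM] maxM] _] := maxset_exists far0.
have {}farM m m' : m \in M -> m' \in M -> m != m' ->
    ~~ e m m' /\ forall x, x \in A -> e m x -> ~~ e m' x.
  move=> mM m'M ne; have /forall_inP/(_ m' m'M) := forall_inP farM m mM.
  rewrite ne => /andP[-> /forall_inP disj]; split=> // x xA emx.
  by have := disj x xA; rewrite emx.
(* An adjacent root takes precedence over a neighbour of a root, as the last conclusion demands. By
   [near], the default [x] is not reached on [A]. *)
pose p x := if x \in M then x else
  if [pick m in M | e x m] is Some m then m else
  if [pick y in A | e x y && [exists m in M, e y m]] is Some y then y else x.
have near x : x \in A -> x \notin M -> (exists2 m, m \in M & e x m) \/
    (exists2 y, y \in A & e x y && [exists m in M, e y m]).
  move=> xA xM; have [xm|/exists_inPn no1] := boolP [exists m in M, e x m].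
    by left; apply/exists_inP.
  (* Otherwise [x] could be added to [M]. *)
  right; apply/exists_inP; apply: contraT => /exists_inPn no2.
  have: x |: M = M.
    apply: maxM; last exact: subsetUr.
    rewrite /far subUset sub1set xA MA /=.
    have no2' y m : y \in A -> m \in M -> ~~ (e x y && e m y).
      move=> yA mM; apply: contra (no2 y yA) => /andP[-> emy].
      by apply/exists_inP; exists m; rewrite // e_sym.
    apply/forall_inP=> m /setU1P mM; apply/forall_inP=> m' /setU1P m'M.
    apply/implyP=> ne.
    case: mM m'M ne => [->|mM] [->|m'M]; rewrite ?eqxx // => ne.
    + by rewrite no1 //; apply/forall_inP=> y yA; exact: no2'.
    + rewrite e_sym no1 //; apply/forall_inP=> y yA; rewrite andbC; exact: no2'.
    have [-> disj] := farM m m' mM m'M ne.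
    by apply/forall_inP=> y yA; rewrite negb_and -implybE; apply/implyP; exact: disj.
  by move/setP/(_ x); rewrite !inE eqxx (negPf xM).
have p1 m x : m \in M -> x \in A -> e m x -> p x = m.
  move=> mM xA emx; rewrite /p.
  have [xM|xM] := boolP (x \in M).
    apply/eqP; rewrite eq_sym; apply/negPn/negP=> ne.
    by have [] := farM m x mM xM ne; rewrite emx.
  case: pickP => [m' /andP[m'M exm']|/(_ m)]; last by rewrite /= mM e_sym emx.
  apply/eqP; rewrite eq_sym; apply/negPn/negP=> ne.
  by have [_ /(_ x xA emx)] := farM m m' mM m'M ne; rewrite e_sym exm'.
have p0 m : m \in M -> p m = m by rewrite /p => ->.
have p2 x : x \in A -> x \notin M ->
    [/\ p x \in A, e x (p x) & p (p x) \in M].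
  move=> xA xM; have [/exists_inP[m mM exm]|/exists_inPn no1] := boolP [exists m in M, e x m].
    have -> : p x = m by apply: p1; rewrite // e_sym.
    by rewrite p0 //; split=> //; exact: (subsetP MA).
  have [[m mM exm]|[y yA exy]] := near x xA xM; first by have := no1 m mM; rewrite exm.
  have -> : p x = odflt x [pick y in A | e x y && [exists m in M, e y m]].
    rewrite /p (negPf xM); case: pickP => [m /andP[mM exm]|_]; last by case: pickP.
    by have := no1 m mM; rewrite exm.
  case: pickP => [z /and3P[zA exz /exists_inP[m mM ezm]]|/(_ y)]; last by rewrite /= yA exy.
  by rewrite (p1 m z) // e_sym.
exists M, p; split; first split=> //.
- move=> x xA; have [xM|xM] := boolP (x \in M); first by rewrite p0.
  by have [] := p2 x xA xM.
- by move=> x xA xM; have [] := p2 x xA xM.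
split=> // x xA; have [xM|xM] := boolP (x \in M); first by rewrite !p0.
by have [] := p2 x xA xM.
Qed.

(* Contracting the trees of depth two around a maximal set of roots at mutual
   distance at least 3 raises the minimum degree and divides the girth by a
   constant, so iterating reaches the minimum degree of [min_degree_packing]. *)
Lemma girth_packing k d : 2 < d ->
  exists L, forall (T : finType) (e : rel T) (A : {set T}),
    symmetric e -> irreflexive e -> A != set0 ->
    {in A, forall x, d <= #|nbr e A x|} -> girth_gt e A L ->
  exists2 s, size s = k & packing e A set0 s.
Proof.
(* [n] counts the contractions still to be made, each of which raises the minimum degree by one. *)
have [n le_n] : exists n, 11 * k <= d + n by exists (11 * k); lia.
elim: n d le_n => [|n IHn] d le_n d3.
  exists 0 => T e A e_sym e_irr A0 degA _; apply: min_degree_packing => // x /degA; lia.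
have [||L IHL] := IHn d.+1; [lia|lia|].
(* [12 * L] leaves girth above [L] after the contraction; the other 12 provides the hypothesis on
   short cycles for the trees. *)
exists (12 * L + 12) => T e A e_sym e_irr A0 degA gA.
have [M [p [[MA p_in p_root p_adj] [pp_root p_star]]]] := packed_roots A e_sym.
have g12 : girth_gt e A 12 by move=> B dB sB; have := gA B dB sB; lia.
have gL : girth_gt e A (12 * L) by move=> B dB sB; have := gA B dB sB; lia.
have [|||||s sz ps] := IHL T (contraction e A p) M.
- exact: contraction_sym.
- exact: contraction_irr.
- case/set0Pn: A0 => x xA; apply/set0Pn; exists (p (p x)); exact: pp_root.
- exact: contraction_degree.
- exact: contraction_girth.
have [s' sz' ps'] := contraction_packing e_sym e_irr MA p_in p_root p_adj pp_root ps.
by exists s'; rewrite // sz'.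
Qed.

(** * The Erdős–Pósa property *)

Definition hits (T : finType) (e : rel T) (A Y : {set T}) :=
  forall B, cyclic e B -> B \subset A -> exists2 x, x \in B & x \in Y.

(** * Suppressing a vertex of degree two *)

Section Suppress.
Variables (T : finType) (e : rel T) (A : {set T}) (v a b : T).
Hypotheses (e_sym : symmetric e) (e_irr : irreflexive e) (vA : v \in A).
Hypotheses (nbr_v : nbr e A v = [set a; b]) (ab : a != b) (nab : ~~ e a b).

(** On the vertex set [A :\ v] this replaces the path from [a] through [v] to [b] by an edge, which
    is new by [nab]. *)
Definition suppress : rel T := fun x y =>
  e x y || ([set x; y] == [set a; b]).

Lemma suppress_sym : symmetric suppress.
Proof. by move=> x y; rewrite /suppress e_sym [[set x; y]]setUC. Qed.

Lemma suppress_irr : irreflexive suppress.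
Proof.
move=> x; rewrite /suppress e_irr /=; apply/negP=> /eqP/(congr1 (fun B : {set T} => #|B|)).
by rewrite setUid cards1 cards2 ab.
Qed.

Lemma nbr_v_in x : x \in [set a; b] -> [/\ x \in A, e v x & x != v].
Proof.
rewrite -nbr_v inE => /andP[-> evx]; split=> //.
by apply: contraTneq evx => ->; rewrite e_irr.
Qed.

Lemma nbr_suppress (B : {set T}) x : x \notin [set a; b] -> nbr suppress B x = nbr e B x.
Proof.
move=> xab; apply/setP=> y; rewrite !inE /suppress.
suff -> : ([set x; y] == [set a; b]) = false by rewrite orbF.
by apply: contraNF xab => /eqP <-; rewrite !inE eqxx.
Qed.

Lemma other_end x : x \in [set a; b] -> exists y, [/\ y \in [set a; b], x != y,
  ~~ e x y & [set a; b] = [set x; y]].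
Proof.
case/set2P=> ->; [exists b | exists a]; rewrite !inE !eqxx ?orbT; split=> //.
- by rewrite eq_sym.
- by rewrite e_sym.
- by rewrite setUC.
Qed.

Lemma nbr_suppress_end (B : {set T}) x y : x != y -> [set a; b] = [set x; y] ->
  y \in B -> nbr suppress B x = y |: nbr e B x.
Proof.
move=> xy eab yB; apply/setP=> w; rewrite !inE /suppress eab.
have [->|wy] := eqVneq w y; first by rewrite yB eqxx orbT.
suff -> : ([set x; w] == [set x; y]) = false by rewrite orbF.
apply/negbTE; apply: contra wy => /eqP/setP/(_ y); rewrite !inE eqxx orbT.
by rewrite eq_sym (negPf xy) /= eq_sym.
Qed.

Lemma nbr_suppress_out (B : {set T}) x : x \in B -> ~~ ([set a; b] \subset B) ->
  nbr suppress B x = nbr e B x.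
Proof.
move=> xB nB; apply/setP=> y; rewrite !inE /suppress.
case yB: (y \in B) => //=.
suff -> : ([set x; y] == [set a; b]) = false by rewrite orbF.
by apply: contraNF nB => /eqP <-; rewrite subUset !sub1set xB.
Qed.

(** A set containing both [a] and [b] may use the new edge and so receives [v]. Removing [v]
    otherwise changes no subset of [A :\ v], but makes the intersection condition of
    [packing_transfer] hold for arbitrary sets. *)
Definition unsuppress (B : {set T}) :=
  if [set a; b] \subset B then v |: B else B :\ v.

Lemma suppress_lift (B : {set T}) : cyclic suppress B -> B \subset A :\ v ->
  cyclic e (unsuppress B) && (unsuppress B \subset A).
Proof.
move=> /cyclicP[B0 degB] sB; have [sBA vB] : B \subset A /\ v \notin B.
  by move: sB; rewrite subsetD1 => /andP.
rewrite /unsuppress; case: ifP => abB; last first.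
  have -> : B :\ v = B by apply/setDidPl; rewrite disjoint_sym disjoints1.
  rewrite sBA andbT; apply/cyclicP; split=> // x xB.
  by rewrite -nbr_suppress_out ?abB // degB.
rewrite subUset sub1set vA sBA !andbT; apply/cyclicP; split.
  by apply/set0Pn; exists v; rewrite !inE eqxx.
have sBv : B \subset v |: B by exact: subsetUr.
move=> x /setU1P[->|xB].
  have <- : #|[set a; b]| = 2 by rewrite cards2 ab.
  apply/subset_leq_card/subsetP=> y yab; rewrite inE (subsetP sBv) ?(subsetP abB) //.
  by have [_ ->] := nbr_v_in yab.
have [xab|xab] := boolP (x \in [set a; b]); last first.
  apply: leq_trans (degB x xB) _; rewrite nbr_suppress //.
  exact/subset_leq_card/sub_nbr.
have [y [yab xy exy eab]] := other_end xab.
apply: leq_trans (degB x xB) _; rewrite (nbr_suppress_end xy eab) ?(subsetP abB) //.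
apply: leq_trans (_ : #|v |: nbr e B x| <= _).
  by rewrite !cardsU1; case: (y \notin _) => //; rewrite inE (negPf vB) leq_add2r.
apply/subset_leq_card/subsetP=> w /setU1P[->|].
  by rewrite !inE eqxx e_sym; have [_ ->] := nbr_v_in xab.
exact/subsetP/sub_nbr.
Qed.

(** A cyclic set through [v] contains [a] and [b]; when [v] is dropped, each of them gains the other
    as a neighbour. *)
Lemma suppress_proj (B : {set T}) : cyclic e B -> B \subset A ->
  exists2 C, cyclic suppress C & (C \subset A :\ v) && (C \subset B).
Proof.
move=> cB sB; have /cyclicP[B0 degB] := cB.
have [vB|vB] := boolP (v \in B); last first.
  exists B; last by rewrite subsetD1 sB vB subxx.
  apply/cyclicP; split=> // x xB; apply: leq_trans (degB x xB) _.
  by apply/subset_leq_card/subsetP=> y; rewrite !inE /suppress => /andP[-> ->].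
have abB : [set a; b] \subset B.
  have : nbr e B v == [set a; b].
    by rewrite eqEcard -nbr_v sub_nbr //= nbr_v cards2 ab degB.
  by move/eqP <-; apply/subsetP=> x; rewrite inE => /andP[].
have abBv : [set a; b] \subset B :\ v.
  by rewrite subsetD1 abB; apply/negP=> /nbr_v_in[_ _]; rewrite eqxx.
exists (B :\ v); last by rewrite setSD //= subsetDl.
apply/cyclicP; split.
  by apply/set0Pn; exists a; rewrite (subsetP abBv) // !inE eqxx.
move=> x /setD1P[xv xB].
have [xab|xab] := boolP (x \in [set a; b]); last first.
  rewrite nbr_suppress //; apply: leq_trans (degB x xB) _.
  apply/subset_leq_card/subsetP=> y; rewrite !inE => /andP[yB exy].
  rewrite yB exy !andbT; apply: contraNneq xab => yv.
  by rewrite -nbr_v inE (subsetP sB) //= e_sym -yv.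
have [y [yab xy exy eab]] := other_end xab.
rewrite (nbr_suppress_end xy eab) ?(subsetP abBv) //.
rewrite cardsU1 [y \in _]inE (negPf exy) andbF.
apply: leq_trans (degB x xB) _; apply: leq_trans (_ : #|v |: nbr e (B :\ v) x| <= _).
  apply/subset_leq_card/subsetP=> w; rewrite !inE => /andP[wB exw].
  by rewrite wB exw; case: eqP.
by rewrite cardsU1 leq_add2r; case: (_ \notin _).
Qed.

(** Two members that both receive [v] would share [a] and [b], which do not both lie in [R]. *)
Lemma suppress_packing (R : {set T}) s : ~~ ([set a; b] \subset R) ->
  packing suppress (A :\ v) R s -> exists2 s', size s' = size s & packing e A R s'.
Proof.
move=> abR; apply: (@packing_transfer _ _ _ _ _ _ _ unsuppress).
  move=> B cB sB; exists (unsuppress B); rewrite ?subxx ?andbT //;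
    by case/andP: (suppress_lift cB sB).
move=> B C; rewrite /unsuppress => BC.
case: ifP => abB; case: ifP => abC.
- by case/negP: abR; apply: subset_trans BC; rewrite subsetI abB.
- apply: subset_trans BC; apply/subsetP=> x; rewrite !inE.
  by case/andP=> /orP[->|->] // /andP[].
- apply: subset_trans BC; apply/subsetP=> x; rewrite !inE.
  by case/andP=> /andP[/negPf-> ->].
- by apply: subset_trans BC; rewrite setISS ?subsetDl.
Qed.

End Suppress.

(** The outer induction on [k] removes a short cycle and adds it to the hitting set. Without short
    cycles, the inner induction on [#|A|] removes or suppresses vertices of degree at most 2, until
    [girth_packing] applies. *)
Lemma erdos_posa k : exists N, forall (T : finType) (e : rel T) (A : {set T}),
  symmetric e -> irreflexive e ->
  (exists2 s, size s = k & packing e A set0 s) \/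
  (exists2 Z : {set T}, #|Z| <= N & hits e A Z).
Proof.
elim: k => [|k [N IHk]]; first by exists 0 => T e A _ _; left; exists [::].
have [L gL] := @girth_packing k.+1 3 isT.
(* [N] vertices hit what is left after removing a short cyclic set, which has at most [L + 3]
   vertices. The 3 makes triangles short, so that the neighbours of a vertex to be suppressed are
   non-adjacent. *)
exists (N + L + 3) => T e A; have [n] := ubnP #|A|.
elim: n e A => // n IHn e A ltAn e_sym e_irr.
have [[B [cB sB leB]]|no_short] :=
    pselect (exists B : {set T}, [/\ cyclic e B, B \subset A & #|B| <= L + 3]).
  have [[s sz ps]|[Z leZ hZ]] := IHk T e (A :\: B) e_sym e_irr.
    left; exists (B :: s); rewrite /= ?sz //.
    apply: packing_extend ps (subsetDl _ _) cB sB _.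
    by rewrite setIC setIDAC -setIDA setDv setI0.
  right; exists (Z :|: B).
    by apply: leq_trans (leq_card_setU _ _) _; rewrite -addnA leq_add.
  move=> D cD sD; have [dDB|] := boolP [disjoint D & B]; last first.
    rewrite -setI_eq0 => /set0Pn[x /setIP[xD xB]].
    by exists x; rewrite // inE xB orbT.
  have [|x xD xZ] := hZ D cD; last by exists x; rewrite // inE xZ.
  by rewrite subsetD sD.
have reduce v e' : v \in A -> symmetric e' -> irreflexive e' ->
    (forall s, packing e' (A :\ v) set0 s ->
       exists2 s', size s' = size s & packing e A set0 s') ->
    (forall B, cyclic e B -> B \subset A ->
       exists2 C, cyclic e' C & (C \subset A :\ v) && (C \subset B)) ->
    (exists2 s, size s = k.+1 & packing e A set0 s) \/
    (exists2 Z : {set T}, #|Z| <= N + L + 3 & hits e A Z).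
  move=> vA e'_sym e'_irr lift proj.
  have ltAv : #|A :\ v| < n by move: ltAn; rewrite (cardsD1 v) vA.
  have [[s sz /lift[s' sz' ps']]|[Z leZ hZ]] := IHn e' (A :\ v) ltAv e'_sym e'_irr.
    by left; exists s'; rewrite ?sz'.
  right; exists Z => // B cB sB; have [C cC /andP[sCA sCB]] := proj B cB sB.
  by have [x xC xZ] := hZ C cC sCA; exists x; rewrite ?(subsetP sCB).
have [/exists_inP[v vA deg1]|/exists_inPn deg2] :=
    boolP [exists v in A, #|nbr e A v| <= 1].
  apply: (reduce v e) => // [s ps|B cB sB].
    by exists s; rewrite ?(packing_sub _ ps) ?subsetDl.
  by exists B; rewrite // subxx andbT (cyclicD1 deg1).
have [/exists_inP[v vA /cards2P[a [b [ab nbr_v]]]]|/exists_inPn deg3] :=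
    boolP [exists v in A, #|nbr e A v| == 2].
  have nab : ~~ e a b.
    apply/negP=> eab; apply: no_short; exists [set v; a; b].
    have inN x : x \in [set a; b] -> x \in A /\ e v x by rewrite -nbr_v inE => /andP.
    have [[aA eva] [bA evb]] := (inN a (set21 a b), inN b (set22 a b)).
    split; first by apply: cyclic3; rewrite // e_sym.
      by rewrite !subUset !sub1set vA aA bA.
    apply: leq_trans (leq_card_setU _ _) _; rewrite cards1 cards2.
    by case: (_ != _); rewrite ?addnS ?addn0 //; lia.
  apply: (reduce v (suppress e a b)) => //.
  - exact: suppress_sym.
  - exact: suppress_irr.
  - move=> s; apply: suppress_packing => //; rewrite subset0.
    by apply/set0Pn; exists a; rewrite !inE eqxx.
  - exact: suppress_proj.
have [A0|A0] := eqVneq A set0.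
  right; exists set0; rewrite ?cards0 // A0 => B cB; rewrite subset0 => /eqP B0.
  by case/cyclicP: cB; rewrite B0 eqxx.
left; apply: gL => // [x xA|B dB sB].
  by have := deg2 x xA; have := deg3 x xA; lia.
have [C cC sC] := dense_cyclic e_sym e_irr dB.
apply: leq_trans (subset_leq_card sC); rewrite ltnNge; apply/negP=> leC.
by apply: no_short; exists C; split; rewrite // ?(subset_trans sC) //; lia.
Qed.

(** Since [A :\ z] spans no cycle, some [v] has degree at most 1 there, hence at most 2 in [A]. It
    is deleted or suppressed, unless its two neighbours are adjacent; then they are [z] and some
    [u], and the triangle becomes a petal while [u] joins the hitting set. *)
Lemma flower (T : finType) k (e : rel T) (A : {set T}) z :
  symmetric e -> irreflexive e ->
  (forall B, cyclic e B -> B \subset A -> z \in B) ->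
  (exists2 s, size s = k & packing e A [set z] s) \/
  (exists2 Y : {set T}, (#|Y| <= k) && (z \notin Y) & hits e A Y).
Proof.
have [n] := ubnP #|A|; elim: n k e A => // n IHn k e A ltAn e_sym e_irr zP.
case: k => [|k]; first by left; exists [::].
have [Az0|Az0] := eqVneq (A :\ z) set0.
  right; exists set0; first by rewrite cards0 inE.
  move=> B /(cyclic_card e_irr) B3 sB; have := subset_leq_card sB.
  by rewrite (cardsD1 z A) Az0 cards0; case: (z \in A); lia.
have [v /setD1P[vz vA] degv] : exists2 v, v \in A :\ z & #|nbr e (A :\ z) v| <= 1.
  have : ~~ cyclic e (A :\ z).
    by apply/negP=> /zP/(_ (subsetDl _ _)); rewrite !inE eqxx.
  rewrite /cyclic Az0 /= => /forall_inPn[v vA]; rewrite -leqNgt; by exists v.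
have ltAv : #|A :\ v| < n by move: ltAn; rewrite (cardsD1 v) vA.
have degA2 : #|nbr e A v| <= 2.
  have : #|nbr e A v| <= #|z |: nbr e (A :\ z) v|.
    apply/subset_leq_card/subsetP=> y; rewrite !inE => /andP[-> ->].
    by case: eqP.
  by rewrite cardsU1; case: (_ \notin _); lia.
have [deg1|deg2] := leqP #|nbr e A v| 1.
  have [|[s sz ps]|[Y Y1 hY]] := IHn k.+1 e (A :\ v) ltAv e_sym e_irr.
  - by move=> B cB sB; apply: zP => //; apply: subset_trans sB (subsetDl _ _).
  - by left; exists s; rewrite ?(packing_sub _ ps) ?subsetDl.
  - by right; exists Y => // B cB sB; apply: hY; rewrite // (cyclicD1 deg1).
have /cards2P[a [b [ab nbr_v]]] : #|nbr e A v| == 2 by rewrite eqn_leq degA2.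
have inN x : x \in [set a; b] -> x \in A /\ e v x by rewrite -nbr_v inE => /andP.
have [[aA eva] [bA evb]] := (inN a (set21 a b), inN b (set22 a b)).
have [eab|nab] := boolP (e a b).
  have cT : cyclic e [set v; a; b] by apply: cyclic3; rewrite // e_sym.
  have sT : [set v; a; b] \subset A by rewrite !subUset !sub1set vA aA bA.
  have [u uA [uz eT evu]] : exists2 u, u \in A &
      [/\ u != z, [set v; a; b] = [set v; u; z] & nbr e A v = [set u; z]].
    have := zP _ cT sT; rewrite !inE eq_sym (negPf vz) /= => /orP[]/eqP->.
      by exists b; rewrite // nbr_v eq_sym ab -!setUA [[set a; b]]setUC.
    by exists a.
  have sA' : A :\ v :\ u \subset A by apply: subset_trans (subsetDl _ _) (subsetDl _ _).
  have ltA' := leq_ltn_trans (subset_leq_card (subsetDl _ [set u])) ltAv.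
  have [|[s sz ps]|[Y /andP[leY zY] hY]] := IHn k e (A :\ v :\ u) ltA' e_sym e_irr.
  - by move=> B cB sB; apply: zP => //; apply: subset_trans sB _.
  - left; exists ([set v; a; b] :: s); rewrite /= ?sz //.
    apply: packing_extend ps sA' cT sT _; rewrite eT; apply/subsetP=> x; rewrite !inE.
    by case: (x == v); case: (x == u); case: (x == z); rewrite ?andbF.
  right; exists (u |: Y).
    rewrite cardsU1 !inE negb_or zY [z == u]eq_sym uz !andbT.
    by case: (u \notin Y); rewrite ?ltnS // (leq_trans leY).
  move=> B cB sB; have [uB|uB] := boolP (u \in B); first by exists u; rewrite // !inE eqxx.
  have [|x xB xY] := hY B cB; last by exists x; rewrite // !inE xY orbT.
  (* Without [u] the only possible neighbour of [v] is [z], so a cyclic set that avoids [u] avoids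
     [v] too. *)
  have degu : #|nbr e (A :\ u) v| <= 1.
    rewrite -(cards1 z); apply/subset_leq_card/subsetP=> x.
    rewrite !inE => /andP[/andP[xu xA] evx].
    have : x \in nbr e A v by rewrite inE xA.
    by rewrite evu !inE (negPf xu).
  have : B \subset A :\ u :\ v by apply: cyclicD1 degu _ cB; rewrite subsetD1 sB uB.
  by rewrite !setDDl setUC.
have [|[s sz ps]|[Y Y1 hY]] := IHn k.+1 (suppress e a b) (A :\ v) ltAv
    (suppress_sym a b e_sym) (suppress_irr e_irr ab).
- move=> B cB sB; have /andP[cC sC] := suppress_lift e_sym e_irr vA nbr_v ab nab cB sB.
  have := zP _ cC sC; rewrite /unsuppress; case: ifP => _; rewrite !inE.
    by rewrite eq_sym (negPf vz).
  by case/andP.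
- have abz : ~~ ([set a; b] \subset [set z]).
    by rewrite subUset !sub1set !inE; apply: contra ab => /andP[/eqP-> /eqP->].
  have [s' sz' ps'] := suppress_packing e_sym e_irr vA nbr_v ab nab abz ps.
  by left; exists s'; rewrite ?sz'.
right; exists Y => // B cB sB.
have [C cC /andP[sCA sCB]] := suppress_proj e_sym e_irr nbr_v ab nab cB sB.
by have [x xC xY] := hY C cC sCA; exists x; rewrite ?(subsetP sCB).
Qed.

(** * Bridges *)

Lemma ucycle_cyclic (T : finType) (e : rel T) c : symmetric e ->
  2 < size c -> ucycle e c -> cyclic e [set x in c].
Proof.
move=> e_sym c3 /andP[cyc_c uniq_c]; apply/cyclicP; split.
  by case: c c3 {cyc_c uniq_c} => // x c _; apply/set0Pn; exists x; rewrite !inE eqxx.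
move=> x; rewrite inE => xc; have [i s def_c] := rot_to xc.
rewrite -(rot_uniq i) def_c in uniq_c; rewrite -(rot_cycle i) def_c in cyc_c.
rewrite -(size_rot i) def_c in c3.
have memc y : y \in x :: s -> y \in c by rewrite -def_c mem_rot.
case: s => [|y [|z s]] // in def_c uniq_c cyc_c c3 memc *.
move: cyc_c; rewrite [cycle _ _]/= rcons_path => /and4P[exy _ _ elx].
have yl : y != last z s.
  by apply: contraTneq uniq_c => /= ->; rewrite mem_last /= andbF.
have <- : #|[set y; last z s]| = 2 by rewrite cards2 yl.
apply/subset_leq_card/subsetP=> w /set2P[]->; rewrite !inE.
  by rewrite memc ?exy // !inE eqxx orbT.
by rewrite e_sym elx memc // in_cons in_cons mem_last !orbT.
Qed.

(** A path in [B] is extended at its head [x] until all neighbours of [x] in [B] lie on it. A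
    neighbour other than the next vertex then closes a cycle. *)
Lemma cyclic_ucycle (T : finType) (e : rel T) (B : {set T}) :
  symmetric e -> irreflexive e -> cyclic e B ->
  exists c, [/\ 2 < size c, ucycle e c & {subset c <= B}].
Proof.
move=> e_sym e_irr /cyclicP[/set0Pn[x0 x0B] degB].
suff long n x s : #|B| <= n + size s -> path e x s -> uniq (x :: s) ->
    {subset x :: s <= B} -> exists c, [/\ 2 < size c, ucycle e c & {subset c <= B}].
  apply: (long #|B| x0 [::]) => //; first by rewrite addn0.
  by move=> x; rewrite inE => /eqP->.
elim: n x s => [|n IHn] x s leB xs uniq_xs sB.
  have: size (x :: s) <= size (enum B).
    by apply: uniq_leq_size => // y /sB; rewrite mem_enum.
  by rewrite -cardE /= ltnNge leB.
have [/exists_inP[y yB /andP[exy yxs]]|/exists_inPn closed] :=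
    boolP [exists y in B, e x y && (y \notin x :: s)].
  apply: (IHn y (x :: s)) => /=.
  - by move: leB; rewrite addSnnS.
  - by rewrite e_sym exy.
  - by rewrite yxs.
  - by move=> z; rewrite in_cons => /predU1P[->|/sB].
have in_s y : y \in nbr e B x -> y \in s.
  rewrite inE => /andP[yB exy]; have := closed y yB; rewrite exy negbK in_cons.
  by case/predU1P=> // yx; rewrite yx e_irr in exy.
have xB : x \in B by apply: sB; rewrite in_cons eqxx.
have := degB x xB; case: s => [|y s] in leB xs uniq_xs sB in_s closed * => deg2.
  by have /card_gt0P[y /in_s] := ltnW deg2.
have /card_gt0P[z] : 0 < #|nbr e B x :\ y|.
  by have := cardsD1 y (nbr e B x); case: (_ \in _); lia.
rewrite in_setD1 => /andP[zy znbr]; have := in_s z znbr.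
rewrite in_cons (negPf zy) /= => /splitPr def_s.
case: def_s => s1 s2 in xs uniq_xs sB {leB in_s closed} *.
have exz : e z x by move: znbr; rewrite inE e_sym => /andP[].
exists (x :: y :: rcons s1 z); split.
- by rewrite /= size_rcons.
- apply/andP; split.
    move: xs; rewrite /= -cat_rcons cat_path => /and3P[-> s1_path _].
    by rewrite rcons_path last_rcons s1_path.
  move: uniq_xs; rewrite -cat_rcons -!cat_cons.
  by rewrite cat_uniq => /and3P[].
- move=> w; rewrite -cat_rcons -!cat_cons in sB => w_in; apply: sB.
  by rewrite mem_cat w_in.
Qed.

Lemma bigminn_le (I : finType) (P : pred I) (F : I -> nat) n i :
  P i -> \big[minn/n]_(j | P j) F j <= F i.
Proof.
move=> Pi; have := mem_index_enum i; elim: (index_enum I) => // j s IHs.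
rewrite in_cons big_cons => /predU1P[<-|i_s]; first by rewrite Pi geq_minl.
case: (P j); last exact: IHs.
exact: leq_trans (geq_minr _ _) (IHs i_s).
Qed.

Section Bridges.
Variables (G : sgraph) (X : {set G}).

(* The classes of the reflexive transitive closure of this relation are the
   X-bridges of G. *)
Definition meet_outside : rel {set G} := fun E1 E2 =>
  [&& E1 \in edges G, E2 \in edges G & E1 :&: E2 :\: X != set0].

Definition adj_outside : rel G := fun u v =>
  [&& adj u v, u \notin X & v \notin X].

Definition bridges := equivalence_partition (connect meet_outside) (edges G).

Lemma meet_outside_sym : symmetric meet_outside.
Proof. by move=> E1 E2; rewrite /meet_outside andbCA [E1 :&: E2]setIC. Qed.

Lemma connect_equiv : {in edges G & &, equivalence_rel (connect meet_outside)}.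
Proof.
move=> E1 E2 E3 _ _ _; split; first exact: connect0.
move=> c12; have c21 : connect meet_outside E2 E1.
  by rewrite (sym_connect_sym meet_outside_sym).
by apply/idP/idP; exact: connect_trans.
Qed.

Lemma bridges_partition : partition bridges (edges G).
Proof. exact: equivalence_partitionP connect_equiv. Qed.

Lemma bridge_mem F E : F \in bridges -> E \in F ->
  E \in edges G /\ forall E', E' \in edges G -> (E' \in F) = connect meet_outside E E'.
Proof.
move=> FP EF; have /and3P[/eqP cov triv _] := bridges_partition.
have EG : E \in edges G by rewrite -cov; apply/bigcupP; exists F.
split=> // E' E'G; rewrite -(def_pblock triv FP EF).
exact: pblock_equivalence_partition connect_equiv _ _ EG E'G.
Qed.

(** Two edges that share a vertex outside [X] are in the same bridge. *)
Lemma bridges_boundary : boundary bridges \subset X.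
Proof.
apply/subsetP=> v; rewrite inE => /exists_inP[F1 F1P /exists_inP[F2 F2P]].
case/and3P=> ne /bigcupP[E1 E1F vE1] /bigcupP[E2 E2F vE2].
apply: contraNT ne => vX.
have [E1G memF1] := bridge_mem F1P E1F; have [E2G _] := bridge_mem F2P E2F.
have E2F1 : E2 \in F1.
  rewrite memF1 // connect1 // /meet_outside E1G E2G /=.
  by apply/set0Pn; exists v; rewrite !inE vX vE1.
have /and3P[_ triv _] := bridges_partition.
by rewrite -(def_pblock triv F1P E2F1) -(def_pblock triv F2P E2F).
Qed.

Lemma edge_connect E u v : E \in edges G -> u \in E :\: X -> v \in E :\: X ->
  connect adj_outside u v.
Proof.
case/imset2P=> a b _; rewrite inE => /andP[_ ab] ->.
rewrite !inE => /andP[uX uE] /andP[vX vE].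
have [->|uv] := eqVneq u v; first exact: connect0.
apply: connect1; rewrite /adj_outside uX vX !andbT.
case/orP: uE uv => /eqP->; case/orP: vE => /eqP->; rewrite ?eqxx // => _.
by rewrite adj_sym.
Qed.

Lemma bridge_connect E1 E2 u v : E1 \in edges G -> connect meet_outside E1 E2 ->
  u \in E1 :\: X -> v \in E2 :\: X -> connect adj_outside u v.
Proof.
move=> + /connectP[s]; elim: s E1 u => [|E s IHs] E1 u /= E1G.
  by move=> _ -> uE vE; exact: edge_connect uE vE.
case/andP=> /and3P[_ EG /set0Pn[w /setDP[/setIP[wE1 wE] wX]]] path_s def_E2 uE1 vE2.
apply: (@connect_trans _ _ w); last by apply: (IHs E) => //; rewrite inE wX.
by apply: (edge_connect E1G) => //; rewrite inE wX.
Qed.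

Hypothesis hit2 : forall B : {set G}, cyclic (@adj G) B -> 1 < #|B :&: X|.

(** A cycle in a bridge contains some [x] in [X], and its neighbours [y] and [z] on the cycle lie
    outside [X]. The bridge links [y] to [z] by a path avoiding [X], and with [x] this path forms a
    cycle meeting [X] only in [x]. *)
Lemma bridge_forest F : F \in bridges -> forest (edge_induced F).
Proof.
move=> FP [c [c3 /andP[cyc_c uniq_c]]].
have val_adj : {homo val : x y / @adj (edge_induced F) x y >-> @adj G x y}.
  by move=> x y /andP[].
have cyc_val : ucycle (@adj G) (map val c).
  by apply/andP; split; [exact: homo_cycle cyc_c | rewrite map_inj_uniq //; exact: val_inj].
have := hit2 (ucycle_cyclic (@adj_sym G) _ cyc_val); rewrite size_map => /(_ c3).
case/ltnW/card_gt0P=> x0; rewrite !inE => /andP[/mapP[x xc ->] xX] {x0}.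
have [i s def_c] := rot_to xc.
rewrite -(rot_uniq i) def_c in uniq_c; rewrite -(rot_cycle i) def_c in cyc_c.
rewrite -(size_rot i) def_c in c3.
case: s => [|y [|z0 s]] // in def_c uniq_c cyc_c c3.
move: cyc_c; rewrite [cycle _ _]/= rcons_path.
set z := last z0 s => /and4P[/andP[xy xyF] _ _ /andP[zx zxF]].
have yz : val y != val z.
  rewrite (inj_eq val_inj); apply: contraTneq uniq_c => ->.
  by rewrite /= mem_last /= andbF.
(* An edge with both ends in [X] meets no edge outside [X], so it is a bridge by itself and cannot
   share its part with a second edge. *)
have notX a b : adj (val x) a -> adj (val x) b -> a != b ->
    [set val x; a] \in F -> [set val x; b] \in F -> a \notin X.
  move=> xa xb ab aF bF; apply/negP=> aX.
  have [aG memF] := bridge_mem FP aF; have [bG _] := bridge_mem FP bF.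
  have := bF; rewrite memF // => /connectP[[|E p]] /=.
    move=> _ /setP/(_ b); rewrite !inE eqxx orbT [b == a]eq_sym (negPf ab) orbF.
    by move/esym/eqP=> bx; rewrite bx adj_irrefl in xb.
  case/andP=> /and3P[_ _ /set0Pn[w]]; rewrite !inE => /andP[wX /andP[]].
  by case/orP=> /eqP ew; rewrite ew ?xX ?aX in wX.
have xz : adj (val x) (val z) by rewrite adj_sym.
have xzF : [set val x; val z] \in F by rewrite setUC.
have yX := notX _ _ xy xz yz xyF xzF.
have zX : val z \notin X by apply: (notX _ _ xz xy _ xzF xyF); rewrite eq_sym.
have [xyG memF] := bridge_mem FP xyF; have [xzG _] := bridge_mem FP xzF.
have : connect adj_outside (val y) (val z).
  apply: (@bridge_connect _ [set val x; val z] _ _ xyG); first by rewrite -memF.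
    by rewrite !inE yX eqxx orbT.
  by rewrite !inE zX eqxx orbT.
case/connectP=> p0 p0_path def_z; case: (shortenP p0_path) def_z => p p_path uniq_p _ def_z.
have pX : all (fun w => w \notin X) (val y :: p).
  rewrite /= yX /=; elim: p (val y) p_path {uniq_p def_z} => //= a p IHp b.
  by case/andP=> /and3P[_ _ ->] /IHp.
have cyc2 : ucycle (@adj G) (val x :: val y :: p).
  apply/andP; split.
    rewrite [cycle _ _]/= xy rcons_path -def_z zx andbT /=.
    by apply: sub_path p_path => a b /and3P[].
  by rewrite cons_uniq uniq_p andbT; apply: contraL xX => /(allP pX).
have p0' : 0 < size p by case: (p) def_z => // /eqP; rewrite eq_sym (negPf yz).
have := hit2 (ucycle_cyclic (@adj_sym G) _ cyc2) => /(_ p0'); rewrite ltnNge => /negP; apply.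
rewrite -(cards1 (val x)); apply/subset_leq_card/subsetP=> w.
rewrite 4!inE => /andP[/predU1P[->|/(allP pX)/negPf->]] //.
Qed.

Lemma brittleness_le : brittleness forest G <= #|X|.
Proof.
apply: leq_trans (subset_leq_card bridges_boundary).
apply: bigminn_le; apply/asboolP; split; first exact: bridges_partition.
exact: bridge_forest.
Qed.

End Bridges.

(** * Embedding subdivisions *)

Lemma isomorphic_refl (G : sgraph) : isomorphic G G.
Proof. by exists id => //; exists id. Qed.

Lemma isomorphic_sym (G H : sgraph) : isomorphic G H -> isomorphic H G.
Proof.
case=> f [g fK gK] f_adj; exists g; first by exists f.
by move=> x y; rewrite -f_adj !gK.
Qed.

Lemma sub_path_infix (T : eqType) (e e' : rel T) x s : path e x s ->
  (forall a b, infix [:: a; b] (x :: s) -> e a b -> e' a b) -> path e' x s.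
Proof.
elim: s x => //= y s IHs x /andP[exy ys] sub; apply/andP; split.
  by apply: sub; rewrite ?eqxx ?prefix0s.
by apply: IHs => // a b ab; apply: sub; rewrite ab orbT.
Qed.

Lemma infix2_map (T T' : eqType) (h : T -> T') x y s : injective h ->
  infix [:: h x; h y] (map h s) -> infix [:: x; y] s.
Proof.
move=> h_inj; elim: s => //= z s IHs /orP[/andP[/eqP/h_inj-> ]|/IHs->]; last by rewrite orbT.
by case: s {IHs} => //= w s /andP[/eqP/h_inj-> _]; rewrite !eqxx prefix0s.
Qed.

Section Embedding.
Variables (H G : sgraph) (f : H -> G) (p : H -> H -> seq G).
Hypothesis f_inj : injective f.
Hypothesis p_rev : forall u v : H, adj u v -> p v u = rev (p u v).
Hypothesis p_walk : forall u v : H, adj u v ->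
  path (@adj G) (f u) (rcons (p u v) (f v)).
Hypothesis p_uniq : forall u v : H, adj u v -> uniq (f u :: rcons (p u v) (f v)).
Hypothesis p_avoid : forall u v w : H, adj u v -> f w \notin p u v.
Hypothesis p_disjoint : forall (u v u' v' : H) (x : G), adj u v -> adj u' v' ->
  x \in p u v -> x \in p u' v' -> [set u; v] = [set u'; v'].

Let W : {set G} :=
  [set x | [exists u, x == f u] || [exists u, exists v, adj u v && (x \in p u v)]].

Let F : {set {set G}} :=
  [set E | [exists u, exists v, exists x, exists y,
     [&& adj u v, infix [:: x; y] (f u :: rcons (p u v) (f v)) & E == [set x; y]]]].

Lemma branch_used u : f u \in W.
Proof. by rewrite inE; apply/orP; left; apply/existsP; exists u. Qed.

Lemma inner_used u v x : adj u v -> x \in p u v -> x \in W.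
Proof.
move=> uv xp; rewrite inE; apply/orP; right; apply/existsP; exists u.
by apply/existsP; exists v; rewrite uv.
Qed.

Let K := subgraph W F.
Let f' u : K := exist _ (f u) (branch_used u).
Let p' u v : seq K := pmap insub (p u v).

Lemma val_p' u v : adj u v -> map val (p' u v) = p u v.
Proof.
move=> uv; rewrite (pmap_filter (insubK _)); apply/all_filterP/allP => x xp.
by rewrite isSome_insub; exact: inner_used xp.
Qed.

Lemma val_path' u v : adj u v ->
  map val (f' u :: rcons (p' u v) (f' v)) = f u :: rcons (p u v) (f v).
Proof. by move=> uv; rewrite /= map_rcons val_p'. Qed.

(** [W] and [F] consist of the vertices and edges used by the paths, so the subgraph they form is
    covered by construction and is itself the subdivision. *)
Lemma embedding_minor : topological_minor H G.
Proof.
exists K, W, F; split; last exact: isomorphic_refl.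
exists f', p'; split.
- by move=> u v /(congr1 val); exact: f_inj.
- move=> u v uv; have vu : adj v u by rewrite adj_sym.
  apply: (inj_map val_inj); rewrite map_rev.
  by rewrite (val_p' uv) (val_p' vu) (p_rev uv).
- move=> u v uv; have vE := val_path' uv.
  have {vE} [vE] : val (f' u) :: map val (rcons (p' u v) (f' v)) =
                   f u :: rcons (p u v) (f v) by rewrite -vE.
  suff : path (relpre (val : K -> G) [rel a b | adj a b && ([set a; b] \in F)])
           (f' u) (rcons (p' u v) (f' v)) by [].
  rewrite -path_map vE /=.
  apply: sub_path_infix (p_walk uv) _ => a b ab /= adj_ab; rewrite adj_ab inE /=.
  apply/existsP; exists u; apply/existsP; exists v; apply/existsP; exists a.
  by apply/existsP; exists b; apply/and3P; split.
- by move=> u v uv; rewrite -(map_inj_uniq val_inj) val_path' // p_uniq.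
- move=> u v w uv; apply: contra (p_avoid w uv) => fw.
  by rewrite -val_p' // (map_f val fw).
- move=> u v u' v' x uv uv' xp xp'; apply: (@p_disjoint _ _ _ _ (val x)) => //.
    by rewrite -val_p' // map_f.
  by rewrite -val_p' // map_f.
- move=> x; have := valP x; rewrite inE => /orP[/existsP[u /eqP xu]|].
    by left; exists u; apply: val_inj.
  case/existsP=> u /existsP[v /andP[uv xp]]; right; exists u, v; split=> //.
  by rewrite -(mem_map val_inj) val_p'.
move=> x y /andP[_]; rewrite inE => /existsP[u /existsP[v /existsP[a /existsP[b]]]].
case/and3P=> uv ab /eqP xy.
have xy' : x != y :> K.
  have := p_uniq uv; move/(infix_uniq ab) => /=; rewrite inE andbT => ne.
  apply: contraNneq ne => eq_xy; move: xy; rewrite eq_xy setUid => /setP ab_y.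
  have := ab_y a; have := ab_y b; rewrite !inE !eqxx orbT => /eqP -> /eqP -> //.
(* [F] holds unordered pairs, so the path may traverse the edge from [y] to [x]; the path for [v u]
   then has the right direction. *)
have [[xa yb]|[ya xb]] : (val x = a /\ val y = b) \/ (val y = a /\ val x = b).
  move/setP: xy => xy; have := xy (val x); have := xy (val y); rewrite !inE !eqxx orbT /=.
  move=> /esym/orP[/eqP ya|/eqP yb] /esym/orP[/eqP xa|/eqP xb];
    do ?[by left | by right].
    by case/negP: xy'; apply/eqP/val_inj; exact: (etrans xa (esym ya)).
  by case/negP: xy'; apply/eqP/val_inj; exact: (etrans xb (esym yb)).
- exists u, v; split=> //; rewrite -xa -yb -(val_path' uv) in ab.
  exact: infix2_map val_inj ab.
exists v, u; have vu : adj v u by rewrite adj_sym.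
split=> //; apply: (infix2_map val_inj); rewrite (val_path' vu) (p_rev uv) xb ya.
have -> : f v :: rcons (rev (p u v)) (f u) = rev (f u :: rcons (p u v) (f v)).
  by rewrite rev_cons rev_rcons.
by rewrite -[[:: b; a]]/(rev [:: a; b]) infix_rev.
Qed.

End Embedding.

(** * A cycle as a subdivided triangle *)

Section CycleSegments.
Variables (T : eqType) (e : rel T) (x0 : T) (c : seq T).
Hypotheses (e_sym : symmetric e) (c3 : 2 < size c) (cyc_c : ucycle e c).

(** The branch vertices are the first three of the cycle, at positions 0, 1 and 2. Only the edge
    between positions 2 and 0 is subdivided, by the rest of the cycle. *)
Definition segment t t' : seq T :=
  if (t == 0) && (t' == 2) then rev (drop 3 c) else
  if (t == 2) && (t' == 0) then drop 3 c else [::].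

Lemma segmentP t t' : t < 3 -> t' < 3 -> t != t' ->
  [/\ segment t' t = rev (segment t t'),
      path e (nth x0 c t) (rcons (segment t t') (nth x0 c t')) &
      uniq (nth x0 c t :: rcons (segment t t') (nth x0 c t'))].
Proof.
rewrite /segment; case: c c3 cyc_c => [|x [|y [|z s]]] // _ /andP[].
rewrite [cycle _ _]/= rcons_path => /and4P[exy eyz path_s e_last] /= uniq_c.
have [xys yzs zs us] : [/\ x \notin [:: y, z & s], y \notin z :: s, z \notin s & uniq s].
  by case/and4P: uniq_c.
move: xys yzs; rewrite !inE !negb_or => /and3P[xy xz xs] /andP[yz ys].
have e_yx : e y x by rewrite e_sym.
have e_zy : e z y by rewrite e_sym.
have long : path e z (rcons s x) by rewrite rcons_path path_s.
have uniq_long : uniq (z :: rcons s x).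
  by rewrite /= mem_rcons inE negb_or eq_sym xz zs rcons_uniq xs.
have rev_long : rev (z :: rcons s x) = x :: rcons (rev s) z.
  by rewrite rev_cons rev_rcons.
have long' : path e x (rcons (rev s) z).
  have := rev_path e z (rcons s x); rewrite last_rcons belast_rcons rev_cons => ->.
  by under eq_path do rewrite e_sym.
have uniq_long' : uniq (x :: rcons (rev s) z) by rewrite -rev_long rev_uniq.
have yx : y != x by rewrite eq_sym.
have zy : z != y by rewrite eq_sym.
rewrite /= drop0; case: t => [|[|[|//]]] _; case: t' => [|[|[|//]]] _ //= _;
  by split; rewrite ?revK //= ?inE ?andbT.
Qed.

End CycleSegments.

(** * Embedding fans *)

Section FanMinor.
Variables (G : sgraph) (S : {set complete 3}) (k : nat) (i0 : 'I_k) (x0 : G).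
Variable c : 'I_k -> seq G.
Hypothesis c3 : forall i, 2 < size (c i).
Hypothesis cyc_c : forall i, ucycle (@adj G) (c i).
Hypothesis c_common : forall i j (t : complete 3), t \in S ->
  nth x0 (c i) t = nth x0 (c j) t.
Hypothesis c_meet : forall i j x, i != j -> x \in c i -> x \in c j ->
  exists2 t : complete 3, t \in S & x = nth x0 (c i) t.

(** A common vertex is assigned to the arbitrary copy [i0]; by [c_common] any copy gives the same
    vertex of [G]. *)
Definition fan_copy (u : fan S k) : 'I_k := if u is inr (_, i) then i else i0.
Definition fan_pos (u : fan S k) : complete 3 :=
  match u with inl t => val t | inr (t, _) => val t end.
Definition edge_copy (u v : fan S k) : 'I_k :=
  if u is inr (_, i) then i else fan_copy v.

Let f u := nth x0 (c (fan_copy u)) (fan_pos u).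
Let p u v := segment (c (edge_copy u v)) (fan_pos u) (fan_pos v).

Lemma fan_pos_neq u v : adj u v -> fan_pos u != fan_pos v :> nat.
Proof. by case: u => [a|[a i]]; case: v => [b|[b j]] //= /andP[]. Qed.

Lemma edge_copyC u v : adj u v -> edge_copy v u = edge_copy u v.
Proof.
case: u => [a|[a i]]; case: v => [b|[b j]] //= /andP[/eqP-> _] //.
Qed.

Lemma branch_on_edge u v : adj u v -> f u = nth x0 (c (edge_copy u v)) (fan_pos u).
Proof. by case: u => [[t tS]|[t i]] //= uv; apply: c_common. Qed.

Lemma fan_vertex_eq u v : fan_pos u = fan_pos v ->
  fan_pos u \in S \/ fan_copy u = fan_copy v -> u = v.
Proof.
case: u => [[t tS]|[[t tS] i]]; case: v => [[t' t'S]|[[t' t'S] j]] /= tt'.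
- by move=> _; congr inl; apply: val_inj.
- by exfalso; move/negP: (t'S); apply; rewrite -tt'.
- by exfalso; move/negP: (tS); apply; rewrite tt'.
- case; first by rewrite (negPf tS).
  by move=> ->; congr (inr (_, _)); apply: val_inj.
Qed.

Lemma c_uniq i : uniq (c i). Proof. by case/andP: (cyc_c i). Qed.

Lemma pos_lt i (t : complete 3) : t < size (c i).
Proof. exact: leq_trans (ltn_ord t) (c3 i). Qed.

Lemma c_eq i (t t' : complete 3) : nth x0 (c i) t = nth x0 (c i) t' -> t = t'.
Proof. by move/eqP; rewrite nth_uniq ?pos_lt ?c_uniq // => /eqP/val_inj. Qed.

Lemma nth_drop3 i (t : complete 3) : nth x0 (c i) t \notin drop 3 (c i).
Proof.
have := c_uniq i; rewrite -{1}(cat_take_drop 3 (c i)) cat_uniq => /and3P[_ + _].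
apply: contra => tD; apply/hasP; exists (nth x0 (c i) t) => //.
by rewrite /= -(nth_take _ (ltn_ord t)) mem_nth // size_takel ?ltn_ord // c3.
Qed.

Lemma nth_notin_drop3 i j (t : complete 3) : nth x0 (c j) t \notin drop 3 (c i).
Proof.
have [-> |ij] := eqVneq i j; first exact: nth_drop3.
apply/negP=> tD; have tj : nth x0 (c j) t \in c j by rewrite mem_nth ?pos_lt.
have [s _ eq_s] := c_meet ij (mem_drop tD) tj.
by rewrite eq_s in tD; have := nth_drop3 i s; rewrite tD.
Qed.

Lemma branch_inj_fan : injective f.
Proof.
move=> u v; rewrite /f => fuv.
have [ij|ij] := eqVneq (fan_copy u) (fan_copy v).
  by rewrite ij in fuv; apply: fan_vertex_eq; [exact: c_eq fuv | right].
have fu : f u \in c (fan_copy u) by rewrite mem_nth ?pos_lt.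
have fv : f u \in c (fan_copy v) by rewrite /f fuv mem_nth ?pos_lt.
have [t tS eq_t] := c_meet ij fu fv.
have ut := c_eq eq_t; rewrite -ut in tS.
apply: fan_vertex_eq; last by left.
by apply: (@c_eq (fan_copy v)); rewrite -fuv; apply: c_common.
Qed.

Lemma mem_segment u v x : x \in p u v ->
  x \in drop 3 (c (edge_copy u v)) /\
  ((fan_pos u == 0 :> nat) && (fan_pos v == 2 :> nat) \/
   (fan_pos u == 2 :> nat) && (fan_pos v == 0 :> nat)).
Proof.
rewrite /p /segment; case: ifP => [h|_]; first by rewrite mem_rev; split; [|left].
by case: ifP => [h|//]; split; [|right].
Qed.

Lemma fan_edge_eq u v u' v' : adj u v -> adj u' v' ->
  edge_copy u v = edge_copy u' v' -> fan_pos u = fan_pos u' -> u = u'.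
Proof.
case: u => [a|[a i]]; case: u' => [a'|[a' i']] uv uv' eq_e eq_p;
  apply: fan_vertex_eq => //=.
- by right.
- by left; exact: (valP a).
- by left; rewrite -[val a]/(fan_pos (inr (a, i))) eq_p /=; exact: (valP a').
- by right.
Qed.

(** The [i]-th cycle serves as the subdivided [i]-th triangle. Distinct cycles meet only in branch
    vertices at positions of [S], where all cycles agree. *)
Lemma fan_minor : topological_minor (fan S k) G.
Proof.
have seg u v : adj u v -> _ := fun uv => segmentP x0 (@adj_sym G)
  (c3 (edge_copy u v)) (cyc_c (edge_copy u v))
  (ltn_ord (fan_pos u)) (ltn_ord (fan_pos v)) (fan_pos_neq uv).
have adjC u v : @adj (fan S k) u v -> adj v u by rewrite adj_sym.
have fE u v : adj u v -> f u = nth x0 (c (edge_copy u v)) (fan_pos u) /\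
    f v = nth x0 (c (edge_copy u v)) (fan_pos v).
  move=> uv; rewrite (branch_on_edge uv) (branch_on_edge (adjC _ _ uv)).
  by rewrite (edge_copyC uv).
apply: (@embedding_minor _ _ f p).
- exact: branch_inj_fan.
- by move=> u v uv; have [rev_p _ _] := seg u v uv; rewrite /p (edge_copyC uv).
- by move=> u v uv; have [_ walk _] := seg u v uv; have [-> ->] := fE u v uv.
- by move=> u v uv; have [_ _ un] := seg u v uv; have [-> ->] := fE u v uv.
- move=> u v w uv; apply/negP=> /mem_segment[fw _].
  by have := nth_notin_drop3 (edge_copy u v) (fan_copy w) (fan_pos w); rewrite fw.
move=> u v u' v' x uv uv' /mem_segment[xc pos_uv] /mem_segment[xc' pos_uv'].
(* An inner vertex lies beyond the first three positions, so it is on one cycle only. Within one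
   copy a single edge has inner vertices, and it may appear in either direction. *)
have eq_e : edge_copy u v = edge_copy u' v'.
  apply/eqP/negPn/negP => ne.
  have [t _ xt] := c_meet ne (mem_drop xc) (mem_drop xc').
  by have := nth_drop3 (edge_copy u v) t; rewrite -xt xc.
have vu := adjC _ _ uv; have vu' := adjC _ _ uv'.
have eq_e1 : edge_copy u v = edge_copy v' u' by rewrite (edge_copyC uv').
have eq_e2 : edge_copy v u = edge_copy u' v' by rewrite (edge_copyC uv).
have eq_e3 : edge_copy v u = edge_copy v' u' by rewrite (edge_copyC uv).
have same : fan_pos u = fan_pos u' -> fan_pos v = fan_pos v' -> [set u; v] = [set u'; v'].
  by move=> /(fan_edge_eq uv uv' eq_e) <- /(fan_edge_eq vu vu' eq_e3) <-.
have swap : fan_pos u = fan_pos v' -> fan_pos v = fan_pos u' -> [set u; v] = [set u'; v'].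
  by move=> /(fan_edge_eq uv vu' eq_e1) <- /(fan_edge_eq vu uv' eq_e2) <-; rewrite setUC.
case: pos_uv => /andP[/eqP u1 /eqP v1]; case: pos_uv' => /andP[/eqP u2 /eqP v2].
- by apply: same; apply: val_inj; rewrite /= ?u1 ?v1.
- by apply: swap; apply: val_inj; rewrite /= ?u1 ?v1.
- by apply: swap; apply: val_inj; rewrite /= ?u1 ?v1.
- by apply: same; apply: val_inj; rewrite /= ?u1 ?v1.
Qed.

End FanMinor.

(** * Brittleness of fans and of graphs without large fans *)

Lemma packing_cycles (T : finType) (e : rel T) (A R : {set T}) s k :
  symmetric e -> irreflexive e -> size s = k -> packing e A R s ->
  exists c : 'I_k -> seq T,
    (forall i, [/\ 2 < size (c i), ucycle e (c i) & {subset c i <= A}]) /\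
    (forall i j x, i != j -> x \in c i -> x \in c j -> x \in R).
Proof.
move=> e_sym e_irr sz /andP[/allP s_cyc s_disj].
have s_nth (i : 'I_k) : nth set0 s i \in s by rewrite mem_nth // sz ltn_ord.
have ex_c (i : 'I_k) : exists c,
    [/\ 2 < size c, ucycle e c & {subset c <= nth set0 s i}].
  by apply: cyclic_ucycle => //; case/andP: (s_cyc _ (s_nth i)).
have [c cP] := choice ex_c; exists c; split=> [i|].
  have [? ? sub] := cP i; split=> // x /sub; apply/subsetP.
  by case/andP: (s_cyc _ (s_nth i)).
suff lt_case (i j : 'I_k) x : i < j -> x \in c i -> x \in c j -> x \in R.
  move=> i j x; rewrite -val_eqE neq_ltn => /orP[|] ij xi xj; first exact: lt_case ij xi xj.
  exact: lt_case ij xj xi.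
move=> ij; have [_ _ subi] := cP i; have [_ _ subj] := cP j.
move=> /subi xi /subj xj; have := pairwiseP set0 s_disj i j.
by rewrite !inE sz !ltn_ord => /(_ isT isT ij)/subsetP; apply; rewrite inE xi.
Qed.

Lemma topological_minor_refl (G : sgraph) : topological_minor G G.
Proof.
apply: (@embedding_minor _ _ id (fun _ _ => [::])) => //=.
- by move=> u v ->.
- by move=> u v uv; rewrite inE andbT; apply: contraTneq uv => ->; rewrite adj_irrefl.
Qed.

Lemma edge_in (G : sgraph) (x y : G) : adj x y -> [set x; y] \in edges G.
Proof. by move=> xy; apply/imset2P; exists x y; rewrite ?inE. Qed.

(** The three edges are not all in one part, as this part would contain the triangle. Hence at least
    two of the three pairs of edges are split between parts, and the common vertex of a split pair
    is in the boundary. *)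
Lemma triangle_boundary (G : sgraph) P (x y z : G) :
  class_partition forest P -> adj x y -> adj y z -> adj z x ->
  exists u v, [/\ u != v, u \in [:: x; y; z], v \in [:: x; y; z],
    u \in boundary P & v \in boundary P].
Proof.
move=> [/and3P[/eqP cov triv _] forestP] xy yz zx.
have ne a b : @adj G a b -> a != b by apply: contraTneq => ->; rewrite adj_irrefl.
have block a b : @adj G a b -> pblock P [set a; b] \in P /\ [set a; b] \in pblock P [set a; b].
  by move=> /edge_in ab; rewrite mem_pblock pblock_mem cov.
have [[[P1 m1] [P2 m2]] [P3 m3]] := (block _ _ xy, block _ _ yz, block _ _ zx).
set F1 := pblock P [set x; y] in P1 m1 *; set F2 := pblock P [set y; z] in P2 m2 *.
set F3 := pblock P [set z; x] in P3 m3 *.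
have bd F F' E E' a : F \in P -> F' \in P -> E \in F -> E' \in F' ->
    a \in E -> a \in E' -> F != F' -> a \in boundary P.
  move=> FP F'P EF E'F aE aE' neF; rewrite inE; apply/exists_inP; exists F => //.
  by apply/exists_inP; exists F' => //; apply/and3P; split=> //; apply/bigcupP;
     [exists E | exists E'].
have by_ : F1 != F2 -> y \in boundary P.
  by apply: bd m1 m2 _ _ => //; rewrite !inE eqxx ?orbT.
have bz : F2 != F3 -> z \in boundary P.
  by apply: bd m2 m3 _ _ => //; rewrite !inE eqxx ?orbT.
have bx : F3 != F1 -> x \in boundary P.
  by apply: bd m3 m1 _ _ => //; rewrite !inE eqxx ?orbT.
have [F12|ne12] := eqVneq F1 F2.
  have [F23|ne23] := eqVneq F2 F3; last first.
    exists z, x; split; [exact: ne | by rewrite !inE eqxx !orbT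
      | by rewrite !inE eqxx | exact: bz | apply: bx].
    by rewrite F12 eq_sym.
  case: (forestP _ P1); rewrite -F12 in m2; rewrite -F23 -F12 in m3.
  have cover_in a b : [set a; b] \in F1 -> a \in cover F1.
    by move=> abF; apply/bigcupP; exists [set a; b]; rewrite // !inE eqxx.
  pose x' : edge_induced F1 := exist _ x (cover_in _ _ m1).
  pose y' : edge_induced F1 := exist _ y (cover_in _ _ m2).
  pose z' : edge_induced F1 := exist _ z (cover_in _ _ m3).
  exists [:: x'; y'; z']; split=> //; apply/andP; split.
    have xy' : adj x' y' by exact/andP.
    have yz' : adj y' z' by exact/andP.
    have zx' : adj z' x' by exact/andP.
    by apply/and4P.
  by rewrite /= !inE -!val_eqE /= negb_or !ne // adj_sym.
have [F23|ne23] := eqVneq F2 F3.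
  exists x, y; split; [exact: ne | by rewrite !inE eqxx
    | by rewrite !inE eqxx orbT | apply: bx | exact: by_].
  by rewrite -F23 eq_sym.
by exists y, z; split; [exact: ne | by rewrite !inE eqxx orbT
  | by rewrite !inE eqxx !orbT | exact: by_ | exact: bz].
Qed.

(** * Lower bound for fans *)

Section FanBrittleness.
Variables (S : {set complete 3}) (k : nat).
Hypothesis S1 : #|S| <= 1.

Definition in_copy (i : 'I_k) (v : fan S k) := if v is inr (_, j) then j == i else true.

Lemma in_copy_exists i (t : complete 3) : exists2 v, in_copy i v & fan_pos v = t.
Proof.
have [tS|tS] := boolP (t \in S); first by exists (inl (exist _ t tS)).
by exists (inr (exist _ t tS, i)) => /=.
Qed.

Lemma in_copy_adj i u v : in_copy i u -> in_copy i v -> fan_pos u != fan_pos v ->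
  adj u v.
Proof.
by case: u => [a|[a j]]; case: v => [b|[b j']] //= /eqP-> // /eqP->; rewrite eqxx.
Qed.

(** Of the two boundary vertices in each triangle at most one is common to the copies; the others
    are distinct for distinct copies. *)
Lemma fan_boundary P : class_partition forest P -> k <= #|@boundary (fan S k) P|.
Proof.
move=> partP.
have hit i : exists x, x \in @boundary (fan S k) P /\ exists a, x = inr (a, i) :> fan S k.
  have [u0 c0 p0] := in_copy_exists i (inord 0).
  have [u1 c1 p1] := in_copy_exists i (inord 1).
  have [u2 c2 p2] := in_copy_exists i (inord 2).
  have [x [y [xy xt yt xb yb]]] : exists u v, [/\ u != v, u \in [:: u0; u1; u2],
      v \in [:: u0; u1; u2], u \in boundary P & v \in boundary P].
    by apply: triangle_boundary partP _ _ _; apply: (@in_copy_adj i) => //;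
       rewrite ?p0 ?p1 ?p2 -val_eqE /= !inordK.
  have at_i z : z \in [:: u0; u1; u2] -> in_copy i z by rewrite !inE => /or3P[]/eqP->.
  have := at_i y yt; have := at_i x xt; move: xy xb yb; clear xt yt.
  case: x => [a|[a j]]; last by move=> _ xb _ /eqP <- _; exists (inr (a, j)); split; [|exists a].
  case: y => [b|[b j]]; last by move=> _ _ yb _ /eqP <-; exists (inr (b, j)); split; [|exists b].
  move=> /eqP ab; case: ab; congr inl; apply: val_inj.
  by apply: (card_le1_eqP S1); exact: valP.
have [h hP] := choice hit.
have h_inj : injective h.
  move=> i j hij; have [_ [a ha]] := hP i; have [_ [b hb]] := hP j.
  by move: hij; rewrite ha hb => -[].
rewrite -{1}(card_ord k) -(card_imset _ h_inj); apply/subset_leq_card/subsetP.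
by move=> _ /imsetP[i _ ->]; have [] := hP i.
Qed.

(** Handles the initial value of the minimum that defines [brittleness]. *)
Lemma fan_card : k <= #|fan S k|.
Proof.
have [t tS] : exists t, t \notin S.
  apply/existsP; rewrite -negb_forall; apply/negP=> /forallP allS.
  suff: 3 <= #|S| by lia.
  rewrite -{1}(card_ord 3); apply/subset_leq_card/subsetP=> t _; exact: allS.
pose h (i : 'I_k) : fan S k := inr (exist _ t tS, i).
have h_inj : injective h by move=> i j [].
by rewrite -{1}(card_ord k) -(card_codom h_inj) max_card.
Qed.

Lemma fan_brittleness : k <= brittleness forest (fan S k).
Proof.
apply: (big_ind (fun n => k <= n)); first exact: fan_card.
  by move=> m n km kn; rewrite leq_min km.
by move=> P /asboolP; exact: fan_boundary.
Qed.

End FanBrittleness.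

(** A graph missing from [C] is a minor of some [fan S k]. If this fan were a minor of a graph in
    [C], closure under minors, applied twice, would bring the missing graph into [C]. *)
Lemma no_fan C (S : {set complete 3}) : ideal C -> ~ subclass (fan_ideal S) C ->
  exists2 k, 0 < k & forall G, C G -> ~ topological_minor (fan S k) G.
Proof.
move=> [iso_C minor_C] not_sub; apply: contrapT => no_k; apply: not_sub => H.
case=> k [H' [k0 [H'_minor isoH]]]; apply: contrapT => notCH; apply: no_k.
exists k => // G CG fanG; apply: notCH.
exact: iso_C (isomorphic_sym isoH) (minor_C _ _ H'_minor (minor_C _ _ fanG CG)).
Qed.

Lemma brittleness_bound k0 k1 : 0 < k0 -> 0 < k1 -> exists M, forall G,
  ~ topological_minor (fan (set0 : {set complete 3}) k0) G ->
  ~ topological_minor (fan [set ord0 : complete 3] k1) G ->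
  brittleness forest G <= M.
Proof.
move=> k0_gt0 k1_gt0; have [N ep] := erdos_posa k0.
(* At most [N] vertices for [Z], and at most [k1] more for each of them. *)
exists (N + N * k1) => G no0 no1.
have a_sym := @adj_sym G; have a_irr := @adj_irrefl G.
have [[s sz ps]|[Z leZ hitZ]] := ep G (@adj G) setT a_sym a_irr.
  have [c [cP c_disj]] := packing_cycles a_sym a_irr sz ps.
  have [c_size _ _] := cP (Ordinal k0_gt0).
  case: (c (Ordinal k0_gt0)) c_size => [//|x0 _ _].
  case: no0; apply: (@fan_minor _ _ _ (Ordinal k0_gt0) x0 c).
  - by move=> i; have [] := cP i.
  - by move=> i; have [] := cP i.
  - by move=> i j t; rewrite inE.
  - by move=> i j x ij xi xj; have := c_disj i j x ij xi xj; rewrite inE.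
(* In [A z] the only vertex of [Z] left is [z], apart from which nothing hits cycles for sure; so
   all cycles there pass through [z]. *)
pose A z := z |: ~: Z.
have only_z z B : cyclic (@adj G) B -> B \subset A z -> z \in B.
  move=> cB /subsetP sB; have [x xB xZ] := hitZ B cB (subsetT _).
  by have := sB x xB; rewrite !inE xZ orbF => /eqP <-.
have ex_Y z : exists Y : {set G},
    (#|Y| <= k1) && (z \notin Y) /\ hits (@adj G) (A z) Y.
  have [[s sz ps]|[Y Y1 hY]] := flower k1 a_sym a_irr (only_z z); last by exists Y.
  have [c [cP c_disj]] := packing_cycles a_sym a_irr sz ps.
  have zc i : z \in c i.
    have [c3 cyc_c sub_c] := cP i.
    have := only_z z [set x in c i] (ucycle_cyclic a_sym c3 cyc_c).
    by rewrite inE; apply; apply/subsetP=> x; rewrite inE => /sub_c.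
  (* Each petal is rotated to start at [z], matching the position [ord0] of the common vertex. *)
  pose c' i := rot (index z (c i)) (c i).
  have c'_z i : nth z (c' i) 0 = z.
    by rewrite /c' /rot nth_cat size_drop subn_gt0 index_mem zc nth_drop addn0 nth_index.
  case: no1; apply: (@fan_minor _ _ _ (Ordinal k1_gt0) z c').
  - by move=> i; have [] := cP i; rewrite size_rot.
  - by move=> i; have [_ cyc_c _] := cP i; rewrite /ucycle rot_cycle rot_uniq.
  - by move=> i j t; rewrite inE => /eqP->; rewrite !c'_z.
  move=> i j x ij; rewrite !mem_rot => xi xj.
  have := c_disj i j x ij xi xj; rewrite inE => /eqP->.
  by exists ord0; rewrite ?inE ?c'_z.
have [Y YP] := choice ex_Y.
apply: leq_trans (_ : #|Z :|: \bigcup_(z in Z) Y z| <= _).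
  apply: brittleness_le => B cB.
  suff [x [y [xy xB yB xX yX]]] : exists x y, [/\ x != y, x \in B, y \in B,
      x \in Z :|: \bigcup_(z in Z) Y z & y \in Z :|: \bigcup_(z in Z) Y z].
    have <- : #|[set x; y]| = 2 by rewrite cards2 xy.
    by apply/subset_leq_card/subsetP=> w /set2P[]->; rewrite in_setI ?xB ?yB.
  (* Besides [z], either [B] contains a second vertex of [Z], or [B] lies in [A z] and is hit by
     [Y z], which avoids [z]. *)
  have [z zB zZ] := hitZ B cB (subsetT _).
  have [/exists_inP[w wB /andP[wz wZ]]|/exists_inPn noZ] :=
      boolP [exists w in B, (w != z) && (w \in Z)].
    by exists w, z; split=> //; rewrite inE ?wZ ?zZ.
  have [/andP[_ zY] hY] := YP z.
  have [|w wB wY] := hY B cB.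
    apply/subsetP=> w wB; rewrite !inE.
    by have := noZ w wB; rewrite negb_and negbK.
  exists w, z; split=> //; last by apply/setUP; left.
    by apply: contraNneq zY => wz; rewrite wz in wY.
  by apply/setUP; right; apply/bigcupP; exists z.
apply: leq_trans (leq_card_setU _ _) _; apply: leq_add => //.
apply: leq_trans (_ : \sum_(z in Z) #|Y z| <= _); last first.
  apply: leq_trans (_ : \sum_(z in Z) k1 <= _).
    by apply: leq_sum => z _; have [/andP[]] := YP z.
  by rewrite sum_nat_const leq_mul2r leZ orbT.
apply: (big_rec2 (fun (X : {set G}) n => #|X| <= n)); first by rewrite cards0.
move=> z X n _ leX; apply: leq_trans (leq_card_setU _ _) _; exact: leq_add.
Qed.

Theorem theorem1p3 (C : graph_class) (idC : ideal C) :
  bounded_on (brittleness forest) C <->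
  (forall S : {set complete 3}, #|S| <= 1 -> ~ subclass (fan_ideal S) C).
Proof.
split=> [[M leM] S S1 sub|no_sub].
  (* A fan with [M.+1] triangles has brittleness above [M]. *)
  have /leM : C (fan S M.+1).
    apply: sub; exists M.+1, (fan S M.+1); split=> //; split.
      exact: topological_minor_refl.
    exact: isomorphic_refl.
  by rewrite leqNgt (fan_brittleness _ S1).
have S0 : #|set0 : {set complete 3}| <= 1 by rewrite cards0.
have S1 : #|[set ord0 : complete 3]| <= 1 by rewrite cards1.
have [k0 k0_gt0 no0] := no_fan idC (no_sub _ S0).
have [k1 k1_gt0 no1] := no_fan idC (no_sub _ S1).
have [M leM] := brittleness_bound k0_gt0 k1_gt0.
by exists M => G CG; apply: leM; [exact: no0 | exact: no1].
Qed.
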